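(* Let $\Omega\subset\mathbb{R}^n$ be a bounded domain, $f\in C(\partial\Omega)$, and let $D\subset\Omega$ satisfy $\overline{\operatorname{int}D}=\overline D$. Let $h\in C(\overline\Omega)$ be the unique viscosity solution of $\Delta_\infty h=0$ in $\Omega$ with $h=f$ on $\partial\Omega$, let $z\in C(\overline\Omega)$ be the unique viscosity solution of Jensen's equation $\min\{\Delta_\infty z,|Dz|-1\}=0$ in $\Omega$ with $z=f$ on $\partial\Omega$, and set $$\mathcal{A}=\{x\in\Omega:\ |Dh(x)|<1\},\qquad \mathcal{B}=\mathcal{A}\cap D.$$ Let $u\in C(\overline\Omega)$ be a viscosity solution of $$\min\{\Delta_\infty u,\ |Du|-\chi_D\}=0\ \text{ in }\Omega,\qquad u=f\ \text{ on }\partial\Omega.$$ Then $u(x)=z(x)$ for all $x\in\mathcal{B}$, and $\Delta_\infty u=0$ in $\Omega\setminus\overline{\mathcal{B}}$ in the viscosity sense.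
   Context: $\Delta_\infty u(x)=\sum_{i,j=1}^n u_{ij}(x)u_i(x)u_j(x)$ is the infinity Laplacian, $\chi_E$ is the characteristic function of a set $E$, and $\operatorname{int}D$, $\overline D$ are the topological interior and closure of $D$. Boundary conditions are understood classically (continuous attainment of the boundary values). An upper semicontinuous $u:\Omega\to\mathbb{R}$ is a viscosity subsolution of $\min\{\Delta_\infty u,|Du|-\chi_D\}=0$ in $\Omega$ if, whenever $x\in\Omega$ and $\varphi\in C^2(\Omega)$ are such that $u-\varphi$ has a strict local maximum at $x$, then $\min\{\Delta_\infty\varphi(x),|D\varphi(x)|-\chi_{\operatorname{int}D}(x)\}\ge 0$. A lower semicontinuous $v:\Omega\to\mathbb{R}$ is a viscosity supersolution if, whenever $x\in\Omega$ and $\phi\in C^2(\Omega)$ are such that $v-\phi$ has a strict local minimum at $x$, then $\min\{\Delta_\infty\phi(x),|D\phi(x)|-\chi_{\overline D}(x)\}\le 0$. A continuous function is a viscosity solution if it is both. Viscosity solutions of Jensen's equation $\min\{\Delta_\infty z,|Dz|-1\}=0$ are defined in the same way with both $\chi_{\operatorname{int}D}$ and $\chi_{\overline D}$ replaced by the constant $1$; viscosity solutions of $\Delta_\infty h=0$ are defined in the same way with the test inequalities $\Delta_\infty\varphi(x)\ge0$ (subsolution) and $\Delta_\infty\phi(x)\le 0$ (supersolution). Existence and uniqueness of $h$ and $z$ are known (Jensen), and $h$ is known to be differentiable at every point of $\Omega$ (Evans–Smart), so $\mathcal{A}$ is well defined. *)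

(* Defs.v *)
From HB Require Import structures.
From mathcomp Require Import all_boot all_order all_algebra.
From mathcomp Require Import all_classical all_reals all_analysis.
Set Implicit Arguments.
Unset Strict Implicit.
Unset Printing Implicit Defensive.
Import Order.TTheory GRing.Theory Num.Theory.
Import numFieldNormedType.Exports.
Local Open Scope classical_set_scope.
Local Open Scope ring_scope.

(* R^n is 'rV[R]_n.  Its library norm is the sup norm, used here only for the
   topology and for boundedness; |Du| is measured by [enorm].  Functions on a
   subset of R^n are represented by total functions, of which only the values
   on that subset matter. *)

Section calculus.
Context {R : realType} {n : nat}.
Implicit Types (phi : 'rV[R]_n -> R) (x : 'rV[R]_n).

Definition enorm (p : 'rV[R]_n) : R := Num.sqrt (\sum_i p 0 i ^+ 2).

Definition partial (i : 'I_n) phi x : R := 'D_(delta_mx 0 i) phi x.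

Definition gradient phi x : 'rV[R]_n := \row_i partial i phi x.

Definition infinity_laplacian phi x : R :=
  \sum_i \sum_j partial j (partial i phi) x * partial i phi x * partial j phi x.

Definition C1_on (U : set 'rV[R]_n) phi :=
  [/\ forall x, U x -> {for x, continuous phi},
      forall i x, U x -> derivable phi x (delta_mx 0 i) &
      forall i x, U x -> {for x, continuous (partial i phi)}].

(* Meaningful for open U, where the partial derivatives at a point of U
   depend only on the values in U. *)
Definition C2_on (U : set 'rV[R]_n) phi :=
  C1_on U phi /\ forall i, C1_on U (partial i phi).

Definition boundary (U : set 'rV[R]_n) : set 'rV[R]_n :=
  closure U `\` U°.

End calculus.

Section viscosity.
Context {R : realType} {n : nat}.
Implicit Types (U : set 'rV[R]_n) (u phi : 'rV[R]_n -> R) (x : 'rV[R]_n).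

(* The next four definitions are meant for U open: the neighbourhoods of a
   point of U can then be taken inside U. *)
Definition usc_on U u :=
  forall x a, U x -> u x < a -> \forall y \near x, u y < a.

Definition lsc_on U u :=
  forall x a, U x -> a < u x -> \forall y \near x, a < u y.

Definition strict_local_max u x := \forall y \near x^', u y < u x.

Definition strict_local_min u x := \forall y \near x^', u x < u y.

(* An operator F sends a test function and a point to the left-hand side of
   the equation; discontinuous equations use different operators for
   sub- and supersolutions. *)
Definition operator := ('rV[R]_n -> R) -> 'rV[R]_n -> R.

Definition viscosity_subsolution (F : operator) U u :=
  usc_on U u /\
  forall x phi, U x -> C2_on U phi ->
    strict_local_max (fun y => u y - phi y) x -> 0 <= F phi x.

Definition viscosity_supersolution (F : operator) U u :=
  lsc_on U u /\
  forall x phi, U x -> C2_on U phi ->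
    strict_local_min (fun y => u y - phi y) x -> F phi x <= 0.

Definition viscosity_solution (Fsub Fsup : operator) U u :=
  [/\ {within U, continuous u},
      viscosity_subsolution Fsub U u &
      viscosity_supersolution Fsup U u].

(* min {Delta_infty phi, |D phi| - c} *)
Definition gradient_constraint (c : 'rV[R]_n -> R) : operator :=
  fun phi x => Num.min (infinity_laplacian phi x) (enorm (gradient phi x) - c x).

Definition infinity_harmonic U u :=
  viscosity_solution infinity_laplacian infinity_laplacian U u.

Definition jensen_solution U u :=
  viscosity_solution (gradient_constraint (cst 1)) (gradient_constraint (cst 1))
    U u.

Definition constrained_solution (D : set 'rV[R]_n) U u :=
  viscosity_solution (gradient_constraint (\1_(D°)))
    (gradient_constraint (\1_(closure D))) U u.

Definition dirichlet (sol : set 'rV[R]_n -> ('rV[R]_n -> R) -> Prop) U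
    (f : 'rV[R]_n -> R) u :=
  [/\ {within closure U, continuous u}, sol U u &
      forall x, boundary U x -> u x = f x].

(* Uniqueness is as a function on the closure of U. *)
Definition unique_dirichlet (sol : set 'rV[R]_n -> ('rV[R]_n -> R) -> Prop) U
    (f : 'rV[R]_n -> R) u :=
  dirichlet sol U f u /\
  forall v, dirichlet sol U f v -> forall x, closure U x -> v x = u x.

Definition small_gradient_set U (h : 'rV[R]_n -> R) : set 'rV[R]_n :=
  [set x | U x /\ enorm (gradient h x) < 1].

End viscosity.

(* Main.v *)
Require Import Defs.
From HB Require Import structures.
From mathcomp Require Import all_boot all_order all_algebra.
From mathcomp Require Import all_classical all_reals all_analysis.
From mathcomp Require Import ring lra.
Set Implicit Arguments.
Unset Strict Implicit.
Unset Printing Implicit Defensive.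
Import Order.TTheory GRing.Theory Num.Theory.
Import numFieldNormedType.Exports.
Local Open Scope classical_set_scope.
Local Open Scope ring_scope.

(** Let A = {|Dh| < 1}. Subsolutions of the infinity Laplace equation enjoy
    comparison with cones, so a maximum point over a ball of radius r increases
    the value at a rate which is at most the slope there. Hence steepest ascent
    of h started outside A stays outside A and gains at least the distance
    covered. Let w be h outside A and, inside A, the supremum of h(y) - length
    over polygonal lines that leave A only at their end point y. Then w has
    slope at least 1 everywhere and its increments double with the radius, which
    is all that the comparison argument of Armstrong and Smart uses of a
    subsolution of Jensen's equation; this gives w <= u <= h and w <= z <= h,
    with equality outside A. Conversely, at a point of A where |Du| >= 1
    holds nearby, steepest ascent of u keeps slope at least 1 until it leaves A,
    where u = w; as w drops at most by the length of the path, u <= w at the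
    starting point. The same applies to z, whence u = w = z in the part of A
    inside the interior of D. Outside the closure of A and D, a test function
    touching u from below either meets the unconstrained equation or touches h,
    because u = h outside A. *)

(** * The Euclidean norm *)

Section euclidean_norm.
Context {R : realType} {n : nat}.
Implicit Types p q x y : 'rV[R]_n.

Definition dot p q : R := \sum_i p 0 i * q 0 i.

Lemma dotC p q : dot p q = dot q p.
Proof. by apply: eq_bigr => i _; rewrite mulrC. Qed.

Lemma dotDl p p' q : dot (p + p') q = dot p q + dot p' q.
Proof. by rewrite -big_split; apply: eq_bigr => i _; rewrite mxE mulrDl. Qed.

Lemma dotZl a p q : dot (a *: p) q = a * dot p q.
Proof. by rewrite /dot mulr_sumr; apply: eq_bigr => i _; rewrite mxE mulrA. Qed.

Lemma dotDr p q q' : dot p (q + q') = dot p q + dot p q'.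
Proof. by rewrite dotC dotDl !(dotC p). Qed.

Lemma dotZr a p q : dot p (a *: q) = a * dot p q.
Proof. by rewrite dotC dotZl dotC. Qed.

Lemma dotNl p q : dot (- p) q = - dot p q.
Proof. by rewrite -scaleN1r dotZl mulN1r. Qed.

Lemma dotNr p q : dot p (- q) = - dot p q.
Proof. by rewrite dotC dotNl dotC. Qed.

Definition dotE := (dotDl, dotDr, dotZl, dotZr, dotNl, dotNr).

Lemma dot_sqrD p q : dot (p + q) (p + q) = dot p p + 2 * dot p q + dot q q.
Proof. by rewrite dotDl !dotDr (dotC q p); ring. Qed.

Lemma dot_ge0 p : 0 <= dot p p.
Proof. by apply: sumr_ge0 => i _; rewrite -expr2 sqr_ge0. Qed.

Lemma enorm_ge0 p : 0 <= enorm p.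
Proof. exact: sqrtr_ge0. Qed.

Lemma enorm_sqr p : enorm p ^+ 2 = dot p p.
Proof.
have E : \sum_i p 0 i ^+ 2 = dot p p by apply: eq_bigr => i _; rewrite expr2.
by rewrite /enorm E sqr_sqrtr // dot_ge0.
Qed.

Lemma enorm_le p c : 0 <= c -> (enorm p <= c) = (dot p p <= c ^+ 2).
Proof. by move=> c0; rewrite -enorm_sqr ler_sqr ?nnegrE ?enorm_ge0. Qed.

Lemma normr_coord_le p i : `|p 0 i| <= enorm p.
Proof.
rewrite -ler_sqr ?nnegrE ?enorm_ge0 ?normr_ge0 // enorm_sqr real_normK ?num_real //.
rewrite /dot (bigD1 i) //= -expr2 lerDl; apply: sumr_ge0 => j _.
by rewrite -expr2 sqr_ge0.
Qed.

Lemma enorm0_eq0 p : enorm p = 0 -> p = 0.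
Proof.
move=> p0; apply/rowP => i; rewrite mxE; apply/eqP; rewrite -normr_eq0.
by rewrite eq_le normr_ge0 andbT -p0 normr_coord_le.
Qed.

Lemma enorm0 : enorm (0 : 'rV[R]_n) = 0.
Proof.
by apply/eqP; rewrite -sqrf_eq0 enorm_sqr /dot big1 // => i _; rewrite mxE mul0r.
Qed.

Lemma enormZ a p : enorm (a *: p) = `|a| * enorm p.
Proof.
apply/eqP; rewrite -(@eqrXn2 _ 2) ?enorm_ge0 ?mulr_ge0 ?enorm_ge0 //.
by rewrite exprMn !enorm_sqr !dotE real_normK ?num_real // expr2 mulrA.
Qed.

Lemma enormN p : enorm (- p) = enorm p.
Proof. by rewrite -scaleN1r enormZ normrN1 mul1r. Qed.

Lemma enormC x y : enorm (x - y) = enorm (y - x).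
Proof. by rewrite -enormN opprB. Qed.

Lemma dot_le p q : dot p q <= enorm p * enorm q.
Proof.
have [/enorm0_eq0 ->|p0] := eqVneq (enorm p) 0.
  by rewrite enorm0 mul0r -(scale0r 0) dotZl mul0r.
have [/enorm0_eq0 ->|q0] := eqVneq (enorm q) 0.
  by rewrite enorm0 mulr0 -(scale0r 0) dotZr mul0r.
have := dot_ge0 (enorm q *: p - enorm p *: q).
have pp : 0 < enorm p by rewrite lt0r p0 enorm_ge0.
have qp : 0 < enorm q by rewrite lt0r q0 enorm_ge0.
rewrite !dotE -!enorm_sqr (dotC q p) => h.
rewrite -(ler_pM2l (mulr_gt0 pp qp)); nra.
Qed.

Lemma enormD p q : enorm (p + q) <= enorm p + enorm q.
Proof.
rewrite enorm_le ?addr_ge0 ?enorm_ge0 // !dotE -!enorm_sqr (dotC q p).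
by have := dot_le p q; nra.
Qed.

Lemma enorm_triangle x y z : enorm (x - z) <= enorm (x - y) + enorm (y - z).
Proof. by rewrite (_ : x - z = (x - y) + (y - z)) ?enormD // addrA subrK. Qed.

Lemma norm_le_enorm p : `|p| <= enorm p.
Proof.
rewrite [leLHS]/Num.norm /= mx_normrE; apply: bigmax_le; first exact: enorm_ge0.
by move=> [i j] _ /=; rewrite (ord1 i) normr_coord_le.
Qed.

Lemma coord_le_norm p i : `|p 0 i| <= `|p|.
Proof.
rewrite [leRHS]/Num.norm /= mx_normrE.
exact: (le_bigmax _ (fun ij : 'I_1 * 'I_n => `|p ij.1 ij.2|) (0, i)).
Qed.

Lemma enorm_le_norm p : enorm p <= n%:R * `|p|.
Proof.
rewrite enorm_le ?mulr_ge0 ?ler0n //.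
have h : dot p p <= \sum_(i < n) `|p| ^+ 2.
  apply: ler_sum => i _; rewrite -expr2 -[p 0 i ^+ 2]real_normK ?num_real //.
  by rewrite ler_sqr ?nnegrE ?normr_ge0 // coord_le_norm.
apply: le_trans h _; rewrite sumr_const card_ord exprMn -[leLHS]mulr_natl.
rewrite ler_wpM2r ?sqr_ge0 // -natrX ler_nat; case: (n) => // m.
by rewrite expnS expn1 leq_pmulr.
Qed.

(** The topology is that of the sup norm, and the two norms bound each other up to the factor [n].
    This lets every later argument use Euclidean balls. *)
Lemma near_enormP x (P : set 'rV[R]_n) :
  (\forall y \near x, P y) <->
  exists2 e, 0 < e & forall y, enorm (y - x) < e -> P y.
Proof.
split.
  rewrite -nbhs_nearE => /nbhs_ballP [e e0 he]; exists e => // y ye; apply: he.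
  rewrite -ball_normE /=; apply: le_lt_trans (norm_le_enorm _) _.
  by rewrite enormC.
move=> [e e0 he]; rewrite -nbhs_nearE; apply/nbhs_ballP.
(* Dividing by [n%:R] would give the radius 0 in dimension 0. *)
exists (e / n.+1%:R) => /=; first by rewrite divr_gt0.
move=> y; rewrite -ball_normE /= => ye; apply: he; rewrite enormC.
apply: le_lt_trans (enorm_le_norm _) _.
rewrite ltr_pdivlMr // mulrC in ye; apply: le_lt_trans ye.
by rewrite ler_wpM2r // ler_nat.
Qed.

Lemma dnear_enormP x (P : set 'rV[R]_n) :
  (\forall y \near x^', P y) <->
  exists2 e, 0 < e & forall y, y != x -> enorm (y - x) < e -> P y.
Proof.
rewrite near_withinE; split=> [/near_enormP|] -[e e0 he].
  by exists e => // y h1 h2; apply: he.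
by apply/near_enormP; exists e => // y h1 h2; apply: he.
Qed.

Lemma continuous_enormP (f : 'rV[R]_n -> R) x :
  {for x, continuous f} <->
  forall e, 0 < e ->
    exists2 d, 0 < d & forall y, enorm (y - x) < d -> `|f y - f x| < e.
Proof.
split=> [/cvgrPdist_lt h e e0|h].
  have /near_enormP [d d0 hd] := h _ e0.
  by exists d => // y /hd; rewrite distrC.
move=> B /nbhs_ballP [e e0 hB]; apply/near_enormP.
have [d d0 hd] := h _ e0; exists d => // y /hd yd; apply: hB.
by rewrite -ball_normE /= distrC.
Qed.

Lemma within_continuous_enormP (K : set 'rV[R]_n) (f : 'rV[R]_n -> R) :
  {within K, continuous f} <->
  forall x, K x -> forall e, 0 < e ->
    exists2 d, 0 < d &
      forall y, K y -> enorm (y - x) < d -> `|f y - f x| < e.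
Proof.
rewrite subspace_continuousP; split=> h x Kx.
  move=> e e0; move/cvgrPdist_lt : (h x Kx) => /(_ e e0).
  rewrite near_withinE => /near_enormP [d d0 hd].
  by exists d => // y Ky /hd /(_ Ky); rewrite distrC.
apply/cvgrPdist_lt => e e0; rewrite near_withinE; apply/near_enormP.
by have [d d0 hd] := h _ Kx _ e0; exists d => // y yd Ky; rewrite distrC hd.
Qed.

Lemma open_enormP (U : set 'rV[R]_n) :
  open U <-> forall x, U x ->
    exists2 e, 0 < e & forall y, enorm (y - x) < e -> U y.
Proof. by rewrite openE; split=> h x /h /near_enormP. Qed.

Lemma closure_enormP (U : set 'rV[R]_n) x :
  closure U x <-> forall e, 0 < e -> exists2 y, U y & enorm (y - x) < e.
Proof.
split=> [h e e0|h B /near_enormP [e e0 hB]].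
  have [|y [Uy ye]] := h (fun y => enorm (y - x) < e).
    by apply/near_enormP; exists e.
  by exists y.
by have [y Uy /hB By] := h _ e0; exists y.
Qed.

End euclidean_norm.

(** * Compactness *)

Section compactness.
Context {R : realType}.

Lemma within_continuous_precomp (T U V : topologicalType) (A : set T) (K : set U)
    (g : T -> U) (f : U -> V) :
  continuous g -> (forall x, A x -> K (g x)) -> {within K, continuous f} ->
  {within A, continuous (fun x => f (g x))}.
Proof.
rewrite !subspace_continuousP => cg AK cf x Ax B /(cf _ (AK _ Ax)).
rewrite /= /nbhs /= /within /= => /(cg x).
by rewrite /nbhs /=; apply: filterS => y h Ay; exact: h (AK _ Ay).
Qed.

Lemma compact_argmax (T : topologicalType) (K : set T) (f : T -> R) :
  compact K -> K !=set0 -> {within K, continuous f} ->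
  exists2 x, K x & forall y, K y -> f y <= f x.
Proof.
move=> cK K0 cf; have [x xK h] := compact_EVT_max K0 cK cf.
exists x; first by rewrite inE in xK.
by move=> y Ky; apply: h; rewrite inE.
Qed.

(** A filter on the superlevel set clusters at some point of [K]. If [f] were below [c] there, it
    would be below [c] at all nearby points of [K], which the filter excludes. *)
Lemma compact_superlevel (T : topologicalType) (K : set T) (f : T -> R) c :
  compact K -> {within K, continuous f} -> compact (K `&` [set y | c <= f y]).
Proof.
move=> cK /subspace_continuousP cf F PF FK.
have FK1 : F K by apply: filterS FK => y [].
have FK2 : F [set y | c <= f y] by apply: filterS FK => y [].
have [p [Kp clp]] := cK F PF FK1; exists p; split => //; split => //=.
rewrite leNgt; apply/negP => fpc.
have : \forall y \near p, K y -> f y < c.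
  have : f y @[y --> within K (nbhs p)] --> f p by exact: cf.
  by move/cvgr_lt => /(_ _ fpc); rewrite near_withinE.
move=> /(clp _ _ FK) [y [[Ky /= cfy] /(_ Ky)]].
by rewrite ltNge cfy.
Qed.

Context {n : nat}.
Implicit Types (x y : 'rV[R]_n) (K : set 'rV[R]_n).

Lemma enormB_continuous x : continuous (fun y => enorm (y - x)).
Proof.
move=> z; apply/continuous_enormP => e e0; exists e => // y; apply: le_lt_trans.
rewrite ler_norml; apply/andP; split.
  by have := enorm_triangle z y x; rewrite (enormC z y); lra.
by have := enorm_triangle y z x; lra.
Qed.

Lemma enorm_continuous : continuous (@enorm R n).
Proof. by move=> x; have := @enormB_continuous 0 x; under eq_fun do rewrite subr0. Qed.

Lemma fst_continuous (U V : topologicalType) : continuous (@fst U V).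
Proof. by move=> x; apply: cvg_fst. Qed.

Lemma snd_continuous (U V : topologicalType) : continuous (@snd U V).
Proof. by move=> x; apply: cvg_snd. Qed.

(** The pairs with [f x - f y >= e] form a compact set off the diagonal. Their least distance serves
    as [d]; if there are none, any [d] does. *)
Lemma within_continuous_compact_uniform K (f : 'rV[R]_n -> R) :
  compact K -> {within K, continuous f} -> forall e, 0 < e ->
  exists2 d, 0 < d & forall x y, K x -> K y -> enorm (x - y) < d ->
    f x - f y < e.
Proof.
move=> cK cf e e0.
pose g (p : 'rV[R]_n * 'rV[R]_n) := f p.1 - f p.2.
pose K2 := (K `*` K) `&` [set p | e <= g p].
have cK2 : compact K2.
  apply: compact_superlevel; first exact: compact_setX.
  have c1 : {within K `*` K, continuous (fun p => f p.1)}.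
    by apply: within_continuous_precomp cf => [|p []//]; exact: fst_continuous.
  have c2 : {within K `*` K, continuous (fun p => f p.2)}.
    by apply: within_continuous_precomp cf => [|p []//]; exact: snd_continuous.
  move=> p; apply: continuousB; [exact: c1|exact: c2].
have [K20|K20] := pselect (K2 !=set0).
  have [|[x y] /= [[Kx Ky] xy] h] := compact_argmax
    (f := fun p : 'rV[R]_n * 'rV[R]_n => - enorm (p.1 - p.2)) cK2 K20.
    apply: continuous_subspaceT => p; apply: cvgN.
    apply: (@continuous_comp _ _ _ (fun q : 'rV[R]_n * 'rV[R]_n => q.1 - q.2));
      last exact: enorm_continuous.
    by apply: continuousB; [exact: fst_continuous|exact: snd_continuous].
  have xy0 : enorm (x - y) != 0.
    apply/eqP => /enorm0_eq0 /eqP; rewrite subr_eq0 => /eqP xy'.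
    by move: xy; rewrite /= /g /= xy' subrr; lra.
  exists (enorm (x - y)); first by rewrite lt0r xy0 enorm_ge0.
  move=> x' y' Kx' Ky' d; rewrite ltNge; apply/negP => h'.
  have := h (x', y'); rewrite /K2 /= /g /= => /(_ (conj (conj Kx' Ky') h')); lra.
exists 1 => // x y Kx Ky _; rewrite ltNge; apply/negP => h'.
by apply: K20; exists (x, y).
Qed.

Definition eball x r : set 'rV[R]_n := [set y | enorm (y - x) <= r].

Lemma compact_eball x r : compact (eball x r).
Proof.
apply: bounded_closed_compact.
  exists (`|x| + r); split; first exact: num_real.
  move=> M hM y /= yx; apply: ltW; apply: le_lt_trans hM.
  rewrite -[y](subrK x) addrC; apply: le_trans (ler_normD _ _) _.
  by rewrite lerD2l; apply: le_trans (norm_le_enorm _) _.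
apply: (@closed_comp _ _ (fun y => enorm (y - x)) [set t | t <= r]).
  by move=> y _; exact: enormB_continuous.
exact: closed_le.
Qed.

Lemma compact_closure_bounded (U : set 'rV[R]_n) :
  bounded_set U -> compact (closure U).
Proof.
move=> bU; apply: bounded_closed_compact; last exact: closed_closure.
have [M [Mr hM]] := bU.
exists M; split => // M' MM' y cy.
apply/ler_addgt0Pr => e e0; have /closure_enormP /(_ e e0) [z Uz zy] := cy.
rewrite -[y](subrK z) addrC; apply: le_trans (ler_normD _ _) _.
apply: lerD; first exact: hM.
by apply: le_trans (norm_le_enorm _) _; rewrite enormC ltW.
Qed.

End compactness.

(** * Quadratic test functions *)

Section quadratic_functions.
Context {R : realType} {n : nat}.
Implicit Types (x y v p b : 'rV[R]_n) (G : 'M[R]_n).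

Lemma is_derive_quadratic_line (f : 'rV[R]_n -> R) y v l c :
  (forall t, f (y + t *: v) = f y + t * l + t ^+ 2 * c) -> is_derive y v f l.
Proof.
move=> h.
have cv : (fun t => t^-1 *: ((f \o shift y) (t *: v) - f y)) @ 0^' --> l.
  apply: (@cvg_trans _ ((fun t : R => l + t * c) @ 0^')).
    apply: near_eq_cvg; rewrite near_withinE; near=> t => t0 /=.
    rewrite [t *: v + y]addrC h /GRing.scale /=.
    by rewrite (_ : f y + t * l + t ^+ 2 * c - f y = t * (l + t * c)) ?mulKf //;
      ring.
  have : (fun t : R => l + t * c) @ (0 : R) --> l + 0 * c.
    by apply: cvgD; [exact: cvg_cst|apply: cvgM; [exact: cvg_id|exact: cvg_cst]].
  by rewrite mul0r addr0; exact: cvg_within_filter.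
split; first by apply/cvg_ex; exists l.
exact: cvg_lim cv.
Unshelve. all: by end_near. Qed.

(** There is no factor 1/2 and [G] may be asymmetric: the Hessian is [G + G^T]. *)
Definition quad x p G y : R := dot p (y - x) + dot ((y - x) *m G) (y - x).

Definition affine x (a : R) b y : R := a + dot b (y - x).

Lemma dot_delta p i : dot p (delta_mx 0 i) = p 0 i.
Proof.
rewrite /dot (bigD1 i) //= big1 ?addr0 ?mxE ?eqxx ?mulr1 // => j ji.
by rewrite mxE (negbTE ji) andbF mulr0.
Qed.

Lemma affine_continuous x a b : continuous (affine x a b).
Proof.
move=> z; apply/continuous_enormP => e e0.
exists (e / (enorm b + 1)); first by rewrite divr_gt0 // ltr_pwDr ?enorm_ge0.
move=> y; rewrite ltr_pdivlMr ?ltr_pwDr ?enorm_ge0 // => h.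
have -> : affine x a b y - affine x a b z = dot b (y - z).
  by rewrite /affine !dotE; ring.
have h1 := dot_le b (y - z); have h2 := dot_le b (- (y - z)).
rewrite dotNr enormN in h2.
rewrite ltr_norml; have := enorm_ge0 (y - z); have := enorm_ge0 b.
by move=> ? ?; apply/andP; split; nra.
Qed.

Lemma is_derive_affine x a b y v : is_derive y v (affine x a b) (dot b v).
Proof.
apply: (is_derive_quadratic_line (c := 0)) => t.
by rewrite /affine addrAC (addrC _ (t *: v)) !dotE; ring.
Qed.

Lemma partial_affine x a b i : partial i (affine x a b) = cst (b 0 i).
Proof.
apply/funext => y; rewrite /partial -dot_delta.
by have [_ ->] := is_derive_affine x a b y (delta_mx 0 i).
Qed.

Lemma C1_affine U x a b : C1_on U (affine x a b).
Proof.
split=> [y _|i y _|i y _]; first exact: affine_continuous.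
  by have [] := is_derive_affine x a b y (delta_mx 0 i).
by rewrite partial_affine; exact: cst_continuous.
Qed.

Lemma dot_mul_delta y G i : dot (y *m G) (delta_mx 0 i) = dot (col i G)^T y.
Proof.
by rewrite dot_delta !mxE dotC; apply: eq_bigr => j _; rewrite !mxE.
Qed.

Lemma mul_delta_row G i : delta_mx 0 i *m G = row i G :> 'rV[R]_n.
Proof. by rewrite rowE. Qed.

Lemma quadE x p G : quad x p G =
  fun y => affine x 0 p y +
    \sum_i affine x 0 (col i G)^T y * affine x 0 (delta_mx 0 i) y.
Proof.
apply/funext => y; rewrite /quad /affine add0r; congr (_ + _).
apply: eq_bigr => i _; rewrite !add0r -dot_mul_delta dot_delta.
by rewrite [dot (delta_mx _ _) _]dotC dot_delta.
Qed.

Lemma quad_continuous x p G : continuous (quad x p G).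
Proof.
rewrite quadE => y; apply: (cvgD (@affine_continuous x 0 p y)).
apply: (@cvg_big _ _ _ _ _ add_continuous _ _ _
  (fun i y => affine x 0 (col i G)^T y * affine x 0 (delta_mx 0 i) y)) => i _.
exact: (cvgM (@affine_continuous x 0 _ y) (@affine_continuous x 0 _ y)).
Qed.

Lemma is_derive_quad x p G y v : is_derive y v (quad x p G)
  (dot p v + dot (v *m G) (y - x) + dot ((y - x) *m G) v).
Proof.
apply: (is_derive_quadratic_line (c := dot (v *m G) v)) => t.
rewrite /quad addrAC (addrC _ (t *: v)) mulmxDl -scalemxAl !dotE; ring.
Qed.

Lemma partial_quad x p G i :
  partial i (quad x p G) = affine x (p 0 i) (row i G + (col i G)^T).
Proof.
apply/funext => y; rewrite /partial.
have [_ ->] := is_derive_quad x p G y (delta_mx 0 i).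
by rewrite mul_delta_row dot_mul_delta dot_delta /affine dotDl addrA.
Qed.

Lemma C2_quad U x p G : C2_on U (quad x p G).
Proof.
split=> [|i]; last by rewrite partial_quad; exact: C1_affine.
split=> [y _|i y _|i y _]; first exact: quad_continuous.
  by have [] := is_derive_quad x p G y (delta_mx 0 i).
by rewrite partial_quad; exact: affine_continuous.
Qed.

Lemma quad_center x p G : quad x p G x = 0.
Proof. by rewrite /quad subrr mul0mx -(scale0r (0 : 'rV[R]_n)) !dotZr !mul0r addr0. Qed.

Lemma gradient_quad x p G : gradient (quad x p G) x = p.
Proof.
apply/rowP => i; rewrite mxE partial_quad /affine subrr -(scale0r 0).
by rewrite dotZr mul0r addr0.
Qed.

Lemma infinity_laplacian_quad x p G :
  infinity_laplacian (quad x p G) x = 2 * dot (p *m G) p.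
Proof.
have pE i : partial i (quad x p G) x = p 0 i.
  by rewrite -[in RHS](gradient_quad x p G) mxE.
rewrite /infinity_laplacian.
under eq_bigr => i _.
  under eq_bigr => j _ do
    rewrite [X in partial j X]partial_quad partial_affine !pE !mxE.
  over.
have E : dot (p *m G) p = \sum_i \sum_j G j i * p 0 i * p 0 j.
  apply: eq_bigr => i _; rewrite mxE mulr_suml; apply: eq_bigr => j _; ring.
rewrite mulr2n mulrDl mul1r {1}E [X in _ = _ + X]E.
rewrite [X in _ = _ + X]exchange_big /= -big_split /=; apply: eq_bigr => i _.
rewrite -big_split /=; apply: eq_bigr => j _; rewrite /cst /=; ring.
Qed.

End quadratic_functions.

(** * Touching by paraboloids and comparison with cones *)

Section touching.
Context {R : realType} {n : nat}.
Implicit Types (U V : set 'rV[R]_n) (u v : 'rV[R]_n -> R) (x y e p : 'rV[R]_n).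

Definition radial_matrix (b g : R) e : 'M[R]_n := b%:M + g *: (e^T *m e).

Lemma dot_radial_matrix b g e p :
  dot (p *m radial_matrix b g e) p = b * dot p p + g * dot e p ^+ 2.
Proof.
rewrite /radial_matrix mulmxDr mul_mx_scalar -scalemxAr mulmxA dotDl !dotZl.
congr (_ + _ * _); have -> : p *m e^T = (dot e p)%:M.
  by apply/matrixP => i j; rewrite !mxE !ord1 /= mulr1n dotC;
    apply: eq_bigr => k _; rewrite mxE.
by rewrite mul_scalar_mx dotZl expr2.
Qed.

(* Only paraboloids whose Hessian is [b I + g e e^T] are needed to touch from
   above at a point where their gradient is [a e]. *)
Definition no_touching_above U (c : R) v :=
  forall x e a b g, U x -> enorm e = 1 -> c < a -> b + g < 0 ->
  ~ strict_local_max (fun y => v y - quad x (a *: e) (radial_matrix b g e) y) x.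

(** A weak form of |Dv| >= 1: the smoothed cones in [slope_ge1] are touched by paraboloids with
    isotropic Hessian. *)
Definition no_small_gradient U v :=
  forall x p b, U x -> enorm p < 1 ->
  ~ strict_local_max (fun y => v y - quad x p (b%:M) y) x.

Lemma dot_radial_lt0 a b g e : enorm e = 1 -> 0 < a -> b + g < 0 ->
  dot (a *: e *m radial_matrix b g e) (a *: e) < 0.
Proof.
move=> e1 a0 bg; rewrite dot_radial_matrix !dotE -enorm_sqr e1.
rewrite (_ : _ + _ = a ^+ 2 * (b + g)); last by ring.
by rewrite pmulr_rlt0 ?exprn_gt0.
Qed.

Lemma no_touching_above_subsolution U v :
  viscosity_subsolution infinity_laplacian U v -> no_touching_above U 0 v.
Proof.
move=> [_ h] x e a b g Ux e1 a0 bg /(h _ _ Ux (C2_quad _ _ _ _)).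
by rewrite infinity_laplacian_quad; have := dot_radial_lt0 e1 a0 bg; lra.
Qed.

Lemma strict_local_minN u x p (G : 'M[R]_n) :
  strict_local_max (fun y => - u y - quad x p G y) x ->
  strict_local_min (fun y => u y - quad x (- p) (- G) y) x.
Proof.
have qN y : quad x (- p) (- G) y = - quad x p G y.
  by rewrite /quad mulmxN !dotNl; ring.
by apply: filterS => y; rewrite !qN; lra.
Qed.

Lemma no_touching_above_supersolution U v :
  viscosity_supersolution infinity_laplacian U v ->
  no_touching_above U 0 (fun y => - v y).
Proof.
move=> [_ h] x e a b g Ux e1 a0 bg /strict_local_minN /(h _ _ Ux (C2_quad _ _ _ _)).
rewrite infinity_laplacian_quad mulmxN mulNmx opprK dotNr.
by have := dot_radial_lt0 e1 a0 bg; lra.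
Qed.

(** At slope [a > 1] the term |D phi| - c of the minimum is positive, so the supersolution
    inequality falls on the infinity Laplacian. *)
Lemma no_touching_above_constraint U v c : (forall x, c x <= 1) ->
  viscosity_supersolution (gradient_constraint c) U v ->
  no_touching_above U 1 (fun y => - v y).
Proof.
move=> c1 [_ h] x e a b g Ux e1 a1 bg /strict_local_minN /(h _ _ Ux (C2_quad _ _ _ _)).
rewrite /gradient_constraint infinity_laplacian_quad mulmxN mulNmx opprK dotNr.
rewrite gradient_quad enormN enormZ e1 ge_min.
have := dot_radial_lt0 e1 (lt_trans ltr01 a1) bg.
by have := c1 x; have := ler_norm a; move=> ? ? ? /orP[]; lra.
Qed.

Lemma subsolution_infinity_laplacian U v c :
  viscosity_subsolution (gradient_constraint c) U v ->
  viscosity_subsolution infinity_laplacian U v.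
Proof.
move=> [usc h]; split=> // x phi Ux C2 /(h _ _ Ux C2).
by rewrite /gradient_constraint le_min => /andP[].
Qed.

Lemma no_small_gradient_subsolution U V v c : V `<=` U ->
  (forall x, V x -> c x = 1) ->
  viscosity_subsolution (gradient_constraint c) U v -> no_small_gradient V v.
Proof.
move=> VU c1 [_ h] x p b Vx p1 /(h _ _ (VU _ Vx) (C2_quad _ _ _ _)).
by rewrite /gradient_constraint gradient_quad c1 // le_min => /andP[_]; lra.
Qed.

Lemma continuous_cone x (a b : R) :
  continuous (fun y => a * enorm (y - x) + b * enorm (y - x) ^+ 2).
Proof.
move=> y; have c := @enormB_continuous _ _ x y.
have ca (t : R) := @cst_continuous 'rV[R]_n R t y.
exact: (cvgD (cvgM (ca a) c) (cvgM (ca b) (cvgM c c))).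
Qed.

Lemma within_continuous_sub K u (g : 'rV[R]_n -> R) :
  {within K, continuous u} -> continuous g ->
  {within K, continuous (fun y => u y - g y)}.
Proof.
by move=> cu cg y; apply: cvgB; [exact: cu|exact: continuous_subspaceT].
Qed.

Lemma eball_center x r : 0 <= r -> eball x r x.
Proof. by rewrite /eball /= subrr enorm0. Qed.

(* The radial second-order expansion, as an exact upper bound: the tangential
   part of [d] enters quadratically, its component [t] along [p] linearly. *)
Lemma enormD_le_quadratic p d t : 0 < enorm p -> dot p d = enorm p * t ->
  - (enorm p / 2) <= t ->
  enorm (p + d) <= enorm p + t + (dot d d - t ^+ 2) / enorm p.
Proof.
set rho := enorm p => rho0 td ht.
have hN0 : 0 <= (dot d d - t ^+ 2) / rho.
  have h1 := dot_le p d; have h2 := dot_le (- p) d.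
  rewrite dotNl enormN -/rho in h2; rewrite -/rho in h1.
  rewrite divr_ge0 ?(ltW rho0) // subr_ge0 -(ler_pM2l (exprn_gt0 2 rho0)).
  by rewrite -exprMn -td -enorm_sqr -exprMn; nra.
rewrite enorm_le; last by lra.
have dE : dot d d = (dot d d - t ^+ 2) / rho * rho + t ^+ 2.
  by rewrite divfK ?subrK // gt_eqF.
rewrite !dotE (dotC d) td -enorm_sqr -/rho.
move: dE hN0; set N := _ / _; move: (dot d d) => D -> N0; nra.
Qed.

(** Take a slope [a > k] and bend the cone by a small concave quadratic term. If [v] minus the bent
    cone exceeded [v x] somewhere, its maximum would lie neither at the centre nor on the sphere.
    There [v] would be touched from above by a paraboloid that is concave along its gradient. *)
Lemma comparison_with_cones U c v x r k :
  no_touching_above U c v -> 0 <= c -> c <= k -> 0 < r -> eball x r `<=` U ->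
  {within eball x r, continuous v} ->
  (forall y, eball x r y -> v y <= v x + k * r) ->
  forall y, eball x r y -> v y <= v x + k * enorm (y - x).
Proof.
move=> nt c0 ck r0 BU cv hv.
suff H a : k < a -> forall y, eball x r y -> v y <= v x + a * enorm (y - x).
  move=> y yB; apply/ler_addgt0Pr => e e0.
  have d0 := enorm_ge0 (y - x).
  have q0 : 0 < e / (enorm (y - x) + 1) by rewrite divr_gt0 // ltr_pwDr.
  have := H (k + e / (enorm (y - x) + 1)); rewrite ltrDl => /(_ q0 _ yB).
  move=> /le_trans; apply; rewrite mulrDl addrA lerD2l.
  rewrite mulrAC ler_pdivrMr ?ltr_pwDr //; nra.
move=> ka.
(* Small enough that the bent cone still exceeds [v x + k * r] on the sphere and that its slope
   [a - 2 * b * rho] stays above [k]. *)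
pose b := (a - k) / (4 * r).
have b0 : 0 < b by rewrite divr_gt0 ?subr_gt0 // mulr_gt0.
have br : b * r = (a - k) / 4 by rewrite /b; field; rewrite gt_eqF.
have [w0 w0B hw0] := compact_argmax (@compact_eball _ _ x r)
  (ex_intro _ x (eball_center _ (ltW r0)))
  (within_continuous_sub cv (@continuous_cone x a (- b))).
set rho := enorm (w0 - x) in hw0; have rho_ge0 : 0 <= rho by exact: enorm_ge0.
have rhor : rho <= r by exact: w0B.
have [small|large] := leP (v w0 - (a * rho + - b * rho ^+ 2)) (v x).
  move=> y yB; have := le_trans (hw0 _ yB) small.
  have := enorm_ge0 (y - x); nra.
exfalso.
have rho_neq0 : rho != 0.
  apply/eqP => rho0; have /eqP := enorm0_eq0 rho0; rewrite subr_eq0 => /eqP w0x.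
  by move: large; rewrite rho0 w0x; lra.
have rho0 : 0 < rho by rewrite lt0r rho_neq0.
have rho_r : rho < r.
  rewrite lt_neqAle rhor andbT; apply/eqP => rhoE.
  by move: large; have := hv _ w0B; rewrite rhoE; nra.
pose e := rho^-1 *: (w0 - x).
have e1 : enorm e = 1.
  by rewrite enormZ -/rho ger0_norm ?invr_ge0 // mulVf.
have al : c < a - 2 * b * rho by nra.
(* The bound of [enormD_le_quadratic] gives the coefficient [a / rho - b]; the extra [b / 2] makes
   the maximum strict. *)
apply: (@nt w0 e _ (a / rho - b / 2) (- (a / rho)) (BU _ w0B) e1 al); first by lra.
apply/dnear_enormP; exists (Num.min (rho / 2) (r - rho)).
  by rewrite lt_min subr_gt0 rho_r divr_gt0.
move=> w ww0; rewrite lt_min => /andP[d1 d2].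
have wB : eball x r w.
  by rewrite /eball /=; have := enorm_triangle w w0 x; rewrite -/rho; lra.
have d0 : 0 < enorm (w - w0).
  rewrite lt0r enorm_ge0 andbT; apply/eqP => /enorm0_eq0 /eqP.
  by rewrite subr_eq0 (negbTE ww0).
have := hw0 _ wB.
have pE : dot (w0 - x) (w - w0) = rho * dot e (w - w0).
  by rewrite /e dotZl mulrA divff // mul1r.
clearbody e.
have wE : w - x = (w0 - x) + (w - w0) by rewrite [RHS]addrC addrA subrK.
have tge : - (rho / 2) <= dot e (w - w0).
  by have := dot_le (- e) (w - w0); rewrite dotNl enormN e1; lra.
have a_ge0 : 0 <= a by lra.
have := ler_wpM2l a_ge0 (enormD_le_quadratic rho0 pE tge); rewrite -/rho -wE.
have sE : enorm (w - x) ^+ 2 =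
    rho ^+ 2 + 2 * (rho * dot e (w - w0)) + enorm (w - w0) ^+ 2.
  by rewrite -pE !enorm_sqr wE dot_sqrD.
have dd0 : 0 < enorm (w - w0) ^+ 2 by rewrite exprn_gt0.
rewrite sE quad_center subr0 /quad dot_radial_matrix dotZl -enorm_sqr.
have : 0 < b * enorm (w - w0) ^+ 2 by rewrite mulr_gt0.
move: (dot e (w - w0)) (enorm (w - w0) ^+ 2) (enorm (w - x)) => t s q; lra.
Qed.

(* The smoothed cone [a sqrt (delta^2 + |w - x|^2)] with a < 1 has slope less
   than 1 everywhere and lies below its tangent paraboloids. *)
Lemma slope_ge1 V v x r : no_small_gradient V v -> 0 < r -> eball x r `<=` V ->
  {within eball x r, continuous v} ->
  exists2 y, eball x r y & v x + r <= v y.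
Proof.
move=> ng r0 BV cv.
have Bx : eball x r x by exact/eball_center/ltW.
have [y yB hy] := compact_argmax (@compact_eball _ _ x r) (ex_intro _ x Bx) cv.
exists y => //; rewrite leNgt; apply/negP => yr.
have M0 : v x <= v y := hy _ Bx.
(* The slope [a] lies between the assumed growth rate [k] and 1. With [delta] as below, the height
   [a * delta] of the smoothed vertex is less than the gain [(a - k) * r] over [v] on the sphere, so
   the maximum is interior. *)
pose k := (v y - v x) / r; pose a := (1 + k) / 2.
have kr : k * r = v y - v x by rewrite /k divfK // gt_eqF.
have k0 : 0 <= k by rewrite divr_ge0 ?subr_ge0 // ltW.
have k1 : k < 1 by rewrite ltr_pdivrMr //; lra.
pose delta := (a - k) * r / 2.
have ak : k < a by rewrite /a; lra.
have a1 : a < 1 by rewrite /a; lra.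
have delta0 : 0 < delta by rewrite divr_gt0 // mulr_gt0 // subr_gt0.
pose rho w := Num.sqrt (delta ^+ 2 + enorm (w - x) ^+ 2).
have rho_sqr w : rho w ^+ 2 = delta ^+ 2 + enorm (w - x) ^+ 2.
  by rewrite sqr_sqrtr // addr_ge0 ?sqr_ge0.
have rho_ge0 w : 0 <= rho w by exact: sqrtr_ge0.
have rho_gt w : enorm (w - x) < rho w.
  rewrite -(@ltr_pXn2r _ 2) ?nnegrE ?enorm_ge0 // rho_sqr ltrDr.
  by rewrite exprn_gt0.
pose sq w := delta ^+ 2 + enorm (w - x) ^+ 2.
have csq : continuous sq.
  move=> w; have ce := @enormB_continuous _ _ x w.
  exact: (cvgD (@cst_continuous 'rV[R]_n R (delta ^+ 2) w) (cvgM ce ce)).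
have crho0 : continuous rho.
  move=> w; exact: (continuous_comp (csq w) (@sqrt_continuous R (sq w))).
have crho : continuous (fun w => a * rho w).
  by move=> w; exact: (cvgM (@cst_continuous 'rV[R]_n R a w) (crho0 w)).
have [w0 w0B hw0] := compact_argmax (@compact_eball _ _ x r) (ex_intro _ x Bx)
  (within_continuous_sub cv crho).
have w0r : enorm (w0 - x) < r.
  rewrite lt_neqAle w0B andbT; apply/eqP => w0E.
  have := hw0 _ Bx; have := hy _ w0B; have := rho_gt w0; rewrite w0E.
  have -> : rho x = delta.
    by rewrite /rho subrr enorm0 expr0n addr0 sqrtr_sqr gtr0_norm.
  move=> h1 h2 h3; have a0 : 0 < a by lra.
  rewrite -(ltr_pM2l a0) in h1.
  have : 0 < (a - k) * r * (1 - a / 2) by rewrite !mulr_gt0 // subr_gt0; lra.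
  rewrite /delta in h3; lra.
have q0 : 0 < rho w0 by apply: le_lt_trans (rho_gt _); exact: enorm_ge0.
apply: (@ng w0 ((a / rho w0) *: (w0 - x)) (a / rho w0 / 2 + 1) (BV _ w0B)).
  rewrite enormZ ger0_norm; last by rewrite divr_ge0 ?(ltW q0) //; lra.
  rewrite mulrAC ltr_pdivrMr // mul1r.
  by have := rho_gt w0; have := enorm_ge0 (w0 - x); nra.
apply/dnear_enormP; exists (r - enorm (w0 - x)); first by rewrite subr_gt0.
move=> w ww0 wr.
have wB : eball x r w by rewrite /eball /=; have := enorm_triangle w w0 x; lra.
have d0 : 0 < enorm (w - w0).
  rewrite lt0r enorm_ge0 andbT; apply/eqP => /enorm0_eq0 /eqP.
  by rewrite subr_eq0 (negbTE ww0).
have := hw0 _ wB.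
rewrite quad_center subr0 /quad mul_mx_scalar !dotZl -!enorm_sqr.
have dd0 : 0 < enorm (w - w0) ^+ 2 by rewrite exprn_gt0.
have sE : rho w ^+ 2 = rho w0 ^+ 2 + 2 * dot (w0 - x) (w - w0) + enorm (w - w0) ^+ 2.
  rewrite !rho_sqr !enorm_sqr -!addrA; congr (_ + _); rewrite addrA -dot_sqrD.
  by rewrite (_ : w - x = (w0 - x) + (w - w0)) // [RHS]addrC addrA subrK.
(* Concavity of the square root, from [(rho w - rho w0) ^+ 2 >= 0]. *)
have rho_le : rho w <=
    rho w0 + (dot (w0 - x) (w - w0) + enorm (w - w0) ^+ 2 / 2) / rho w0.
  rewrite -lerBlDl ler_pdivlMr //; have := sqr_ge0 (rho w - rho w0); nra.
have a0 : 0 <= a by lra.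
have := ler_wpM2l a0 rho_le.
move: dd0; set s := enorm _ ^+ 2; lra.
Qed.

End touching.

(** * The comparison principle *)

Section comparison.
Context {R : realType} {n : nat}.
Implicit Types (U A K : set 'rV[R]_n) (u v : 'rV[R]_n -> R) (x y : 'rV[R]_n).

Definition line x y (t : R) : 'rV[R]_n := x + t *: (y - x).

Lemma line0 x y : line x y 0 = x.
Proof. by rewrite /line scale0r addr0. Qed.

Lemma line1 x y : line x y 1 = y.
Proof. by rewrite /line scale1r addrC subrK. Qed.

Lemma enorm_line x y s t : enorm (line x y s - line x y t) = `|s - t| * enorm (y - x).
Proof.
by rewrite -enormZ; congr enorm; rewrite /line opprD addrACA subrr add0r scalerBl.
Qed.

Lemma line_line x y s t : line (line x y s) y t = line x y (s + t * (1 - s)).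
Proof.
apply/rowP => i; rewrite !mxE; ring.
Qed.

Lemma first_exit A x y : open A -> A x -> ~ A y ->
  exists s, [/\ 0 < s, s <= 1, ~ A (line x y s) &
                forall t, 0 <= t -> t < s -> A (line x y t)].
Proof.
move=> /open_enormP oA Ax nAy.
pose S := [set t : R | 0 <= t /\ ~ A (line x y t)].
have S1 : S 1 by split=> //; rewrite line1.
have hS : has_inf S by split; [exists 1|exists 0 => t []].
have lb t : S t -> inf S <= t by move=> St; apply: ge_inf => //; case: hS.
have s0 : 0 <= inf S by apply: lb_le_inf; [exists 1|move=> t []].
have nA : ~ A (line x y (inf S)).
  move=> /oA [d d0 hd].
  have e0 : 0 < d / (enorm (y - x) + 1) by rewrite divr_gt0 // ltr_pwDr ?enorm_ge0.
  have [t [t0 nAt] ht] := inf_adherent e0 hS.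
  have ti : inf S <= t by apply: lb.
  apply: nAt; apply: hd; rewrite enorm_line ger0_norm ?subr_ge0 //.
  have ts : t - inf S < d / (enorm (y - x) + 1) by lra.
  rewrite ltr_pdivlMr in ts; last by rewrite ltr_pwDr ?enorm_ge0.
  by apply: le_lt_trans ts; rewrite ler_wpM2l ?lerDl // subr_ge0.
exists (inf S); split => //.
- by rewrite lt_neqAle s0 andbT; apply/eqP => e; apply: nA; rewrite -e line0.
- exact: lb.
- by move=> t t0 ts; apply: contrapT => nAt; have /lb := conj t0 nAt; lra.
Qed.

Lemma closure_exit A x y s : 0 < s ->
  (forall t, 0 <= t -> t < s -> A (line x y t)) -> closure A (line x y s).
Proof.
move=> s0 h; apply/closure_enormP => e e0.
pose d := e / (enorm (y - x) + 1).
have d0 : 0 < d by rewrite divr_gt0 // ltr_pwDr ?enorm_ge0.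
have de : d * enorm (y - x) < e.
  by rewrite /d mulrAC ltr_pdivrMr ?ltr_pwDr ?enorm_ge0 //; nra.
have [sd|ds] := leP s d.
  exists (line x y 0); first exact: h.
  rewrite enorm_line sub0r normrN gtr0_norm //; apply: le_lt_trans de.
  by rewrite ler_wpM2r ?enorm_ge0.
exists (line x y (s - d)); first by apply: h; lra.
by rewrite enorm_line addrAC subrr add0r normrN gtr0_norm.
Qed.

(** A finite-difference substitute for being a subsolution: the maximum over balls about a point is
    convex in the radius, so its increment at least doubles with the radius. *)
Definition doubling U v := forall x r a, 0 < r -> eball x (2 * r) `<=` U ->
  eball x r a -> exists2 b, eball x (2 * r) b & 2 * (v a - v x) <= v b - v x.

Definition slope_ge (c : R) U v := forall x r, 0 < r -> eball x r `<=` U ->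
  exists2 y, eball x r y & v x + c * r <= v y.

(** The counterpart for the drops of a supersolution of min{Delta_infty u, |Du| - c} = 0, where
    doubling may fail at rates up to [c]. *)
Definition halving (c : R) U u := forall x r b, 0 < r -> eball x (2 * r) `<=` U ->
  eball x r b -> u x - u b <= c * r \/
  exists2 d, eball x (2 * r) d & 2 * (u x - u b) <= u x - u d.

Lemma doubling_subsolution U v : {within U, continuous v} ->
  no_touching_above U 0 v -> doubling U v.
Proof.
move=> cv nt x r a r0 BU aB.
have r20 : 0 < 2 * r by rewrite mulr_gt0.
have cB := continuous_subspaceW BU cv.
have Bx := eball_center x (ltW r20).
have [b bB hb] := compact_argmax (@compact_eball _ _ x (2 * r)) (ex_intro _ x Bx) cB.
exists b => //; pose k := (v b - v x) / (2 * r).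
have kr : k * (2 * r) = v b - v x by rewrite /k divfK // gt_eqF.
have k0 : 0 <= k by rewrite divr_ge0 ?(ltW r20) // subr_ge0 hb.
have aB2 : eball x (2 * r) a by apply: le_trans aB _; lra.
have H y : eball x (2 * r) y -> v y <= v x + k * (2 * r).
  by rewrite kr => /hb; lra.
have := comparison_with_cones nt (lexx 0) k0 r20 BU cB H aB2.
have : k * enorm (a - x) <= k * r by rewrite ler_wpM2l.
lra.
Qed.

Lemma slope_ge0 U v : slope_ge 0 U v.
Proof.
by move=> x r r0 _; exists x; [exact/eball_center/ltW|rewrite mul0r addr0].
Qed.

(** Cone comparison for [- u] holds for slopes at least [c], so it is used with the larger of [c]
    and the actual rate of decrease. The two values of this maximum give the two alternatives. *)
Lemma halving_supersolution c U u : 0 <= c -> {within U, continuous u} ->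
  no_touching_above U c (fun y => - u y) -> halving c U u.
Proof.
move=> c0 cu nt x r b r0 BU bB.
have r20 : 0 < 2 * r by rewrite mulr_gt0.
have cN : {within U, continuous (fun y => - u y)} by move=> y; apply: cvgN; exact: cu.
have cB := continuous_subspaceW BU cN.
have Bx := eball_center x (ltW r20).
have [d dB hd] := compact_argmax (@compact_eball _ _ x (2 * r)) (ex_intro _ x Bx) cB.
pose m := (u x - u d) / (2 * r); pose k := Num.max c m.
have mr : m * (2 * r) = u x - u d by rewrite /m divfK // gt_eqF.
have ck : c <= k by rewrite le_max lexx.
have mk : m <= k by rewrite le_max lexx orbT.
have bB2 : eball x (2 * r) b by apply: le_trans bB _; lra.
have H : forall y, eball x (2 * r) y -> - u y <= - u x + k * (2 * r).
  move=> y /hd; have : m * (2 * r) <= k * (2 * r) by rewrite ler_wpM2r // ltW.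
  rewrite mr; lra.
have := comparison_with_cones nt c0 ck r20 BU cB H bB2.
have : k * enorm (b - x) <= k * r.
  by rewrite ler_wpM2l // (le_trans c0).
have [cm|mc] := leP c m.
  have -> : k = m by apply/max_idPr.
  by move=> h1 h2; right; exists d => //; lra.
have -> : k = c by apply/max_idPl/ltW.
by move=> h1 h2; left; lra.
Qed.

Lemma enorm_half x y : enorm (line x y 2^-1 - x) = enorm (y - x) / 2.
Proof.
by rewrite -[X in _ - X](line0 x y) enorm_line subr0 ger0_norm ?invr_ge0 // mulrC.
Qed.

Lemma enorm_half_r x y : enorm (y - line x y 2^-1) = enorm (y - x) / 2.
Proof.
rewrite -[X in X - line _ _ _](line1 x y) enorm_line ger0_norm; first lra.
by rewrite subr_ge0; lra.
Qed.

Lemma comparison_principle c U v u (i0 : 'I_n) : 0 <= c ->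
  open U -> bounded_set U ->
  {within closure U, continuous v} -> {within closure U, continuous u} ->
  doubling U v -> slope_ge c U v -> halving c U u ->
  (forall x, boundary U x -> v x <= u x) ->
  forall x, closure U x -> v x <= u x.
Proof.
move=> c0 oU bU cv cu dv sv hu vu x1 Kx1; rewrite leNgt; apply/negP => gt1.
have cK := compact_closure_bounded bU.
pose eta := (v x1 - u x1) / 4.
have eta0 : 0 < eta by rewrite divr_gt0 // subr_gt0.
have [dlv dlv0 hdlv] := within_continuous_compact_uniform cK cv eta0.
have [dlu dlu0 hdlu] := within_continuous_compact_uniform cK cu eta0.
pose dl := Num.min dlv dlu.
have dl0 : 0 < dl by rewrite lt_min dlv0.
(* A boundary point within [2 * r] of the centre of a triple is within [3 * r] of [a] and [b], which
   forces [v a - u b < 2 * eta]. The maximum is at least [4 * eta], so the maximal triples stay away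
   from the boundary. *)
pose r := dl / 4.
have r0 : 0 < r by rewrite divr_gt0.
have r3v : 3 * r < dlv.
  by have : dl <= dlv by [rewrite ge_min lexx]; rewrite /r; lra.
have r3u : 3 * r < dlu.
  by have : dl <= dlu by [rewrite ge_min lexx orbT]; rewrite /r; lra.
pose T0 : set ('rV[R]_n * 'rV[R]_n * 'rV[R]_n) :=
  (closure U `*` closure U) `*` closure U.
pose T := T0 `&` [set p | - r <= - enorm (p.1.2 - p.1.1)]
  `&` [set p | - r <= - enorm (p.2 - p.1.1)].
have c11 : continuous (fun p : 'rV[R]_n * 'rV[R]_n * 'rV[R]_n => p.1.1).
  by move=> p; exact: (continuous_comp (@fst_continuous _ _ p)
    (@fst_continuous _ _ p.1)).
have c12 : continuous (fun p : 'rV[R]_n * 'rV[R]_n * 'rV[R]_n => p.1.2).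
  by move=> p; exact: (continuous_comp (@fst_continuous _ _ p)
    (@snd_continuous _ _ p.1)).
have c2 : continuous (fun p : 'rV[R]_n * 'rV[R]_n * 'rV[R]_n => p.2).
  by move=> p; exact: snd_continuous.
have cT : compact T.
  apply: compact_superlevel; first apply: compact_superlevel.
  - exact: compact_setX (compact_setX cK cK) cK.
  - apply: continuous_subspaceT => p; apply: cvgN.
    exact: (continuous_comp (cvgB (c12 p) (c11 p)) (@enorm_continuous _ _ _)).
  - apply: continuous_subspaceT => p; apply: cvgN.
    exact: (continuous_comp (cvgB (c2 p) (c11 p)) (@enorm_continuous _ _ _)).
have TE x a b : T (x, a, b) <-> [/\ closure U x, closure U a, closure U b,
    enorm (a - x) <= r & enorm (b - x) <= r].
  rewrite /T /T0 /=; split; first by move=> [[[[? ?] ?] ?] ?]; split => //; lra.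
  by move=> [? ? ? ? ?]; do !split => //; lra.
(* Armstrong-Smart: maximise v a - u b over a and b in the ball of radius r about
   x, then v a, then a coordinate of x. The last step is needed when c = 0, where
   v and u may both be constant near x. *)
pose Phi (p : 'rV[R]_n * 'rV[R]_n * 'rV[R]_n) := v p.1.2 - u p.2.
have cva : {within T, continuous (fun p => v p.1.2)}.
  by apply: within_continuous_precomp cv => // p [[[[]]]].
have cub : {within T, continuous (fun p => u p.2)}.
  by apply: within_continuous_precomp cu => // p [[[]]].
have cPhi : {within T, continuous Phi}.
  by move=> p; apply: cvgB; [exact: cva|exact: cub].
have Txx x : closure U x -> T (x, x, x).
  by move=> Kx; apply/TE; split; rewrite ?subrr ?enorm0 ?ltW.
have [p0 Tp0 hp0] := compact_argmax cT (ex_intro _ _ (Txx _ Kx1)) cPhi.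
pose T1 := T `&` [set p | Phi p0 <= Phi p].
have cT1 : compact T1 by exact: compact_superlevel.
have T1T : T1 `<=` T by move=> p [].
have [p1 Tp1 hp1] := compact_argmax cT1 (ex_intro _ p0 (conj Tp0 (lexx _)))
  (continuous_subspaceW T1T cva).
pose T2 := T1 `&` [set p | v p1.1.2 <= v p.1.2].
have cT2 : compact T2.
  exact: compact_superlevel cT1 (continuous_subspaceW T1T cva).
have cx0 : continuous (fun p : 'rV[R]_n * 'rV[R]_n * 'rV[R]_n => p.1.1 0 i0).
  by move=> p; exact: (continuous_comp (c11 p) (@coord_continuous _ _ _ 0 i0 _)).
have [[[x a] b] Tp2 hp2] := compact_argmax cT2 (ex_intro _ p1 (conj Tp1 (lexx _)))
  (continuous_subspaceT cx0).
have {Tp2} [[Txab /= Pab] /= vab] := Tp2.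
have maxPhi x' a' b' : T (x', a', b') -> v a' - u b' <= v a - u b.
  by move=> /hp0 h; exact: le_trans Pab.
have maxv x' a' b' : T (x', a', b') -> v a - u b <= v a' - u b' -> v a' <= v a.
  move=> T' P'; apply: le_trans vab; apply: (hp1 (x', a', b')); split => //=.
  exact: le_trans P'.
have maxx x' a' b' : T (x', a', b') -> v a - u b <= v a' - u b' -> v a <= v a' ->
    x' 0 i0 <= x 0 i0.
  move=> T' P' v'; apply: (hp2 (x', a', b')); split; last exact: le_trans v'.
  by split => //=; exact: le_trans P'.
have {}gt1 : 4 * eta <= v a - u b.
  by apply: le_trans (maxPhi _ _ _ (Txx _ Kx1)); rewrite /eta; lra.
have [Kx Ka Kb ax bx] := (TE _ _ _).1 Txab.
have far q : boundary U q -> ~ eball x (2 * r) q.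
  move=> bq qx; have Kq : closure U q by case: bq.
  have qa : enorm (a - q) < dlv.
    by have := enorm_triangle a x q;
      rewrite (enormC x q); move: qx; rewrite /eball /=; lra.
  have qb : enorm (q - b) < dlu.
    by have := enorm_triangle q x b;
      rewrite (enormC x b); move: qx; rewrite /eball /=; lra.
  have := hdlv _ _ Ka Kq qa; have := hdlu _ _ Kq Kb qb; have := vu _ bq; lra.
have UK y : U y -> closure U y by exact: subset_closure.
have bE q : closure U q -> ~ U q -> boundary U q.
  by move=> Kq nUq; split => //; rewrite (interior_id _).1.
have Ux : U x.
  apply: contrapT => nUx; apply: (far x); first exact: bE.
  by apply: eball_center; lra.
have BU : eball x (2 * r) `<=` U.
  move=> y yB; apply: contrapT => nUy.
  have [s [s0 s1 nUs hs]] := first_exit oU Ux nUy.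
  apply: (far (line x y s)); first by apply: bE => //; exact: closure_exit hs.
  rewrite /eball /= -[X in _ - X](line0 x y) enorm_line subr0 ger0_norm;
    last exact: ltW.
  by apply: le_trans yB; rewrite ler_piMl ?enorm_ge0.
(* Points [x] and [y] at distance at most [2 * r] are both within [r] of their midpoint, which can
   therefore be the centre of an admissible triple containing them. *)
have midT y : eball x (2 * r) y ->
    [/\ U (line x y 2^-1), enorm (line x y 2^-1 - x) <= r &
        enorm (y - line x y 2^-1) <= r].
  rewrite /eball /= => yB; have h : enorm (line x y 2^-1 - x) <= r.
    by rewrite enorm_half; lra.
  by split => //; [apply: BU; rewrite /eball /=; lra|rewrite enorm_half_r; lra].
have [a2 a2B ha2] := dv x r a r0 BU ax.
have aBU : eball a r `<=` eball x (2 * r).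
  by move=> y; rewrite /eball /= => ya; have := enorm_triangle y a x; lra.
have [a3 a3a ha3] := sv a r r0 (subset_trans aBU BU).
(* The better of the points given by [doubling] about [x] and by [slope_ge] about [a] has both
   properties. *)
have [a4 a4B [ha4 ha4']] : exists2 y, eball x (2 * r) y &
    v a - v x <= v y - v a /\ c * r <= v y - v a.
  have [h|h] := leP (v a2) (v a3).
    by exists a3; [exact: aBU|split; lra].
  by exists a2 => //; split; lra.
have P0 : v x <= v a.
  have := maxPhi x x b; rewrite lerD2r; apply.
  by apply/TE; split => //; rewrite subrr enorm0 ltW.
have RQ : v a4 - v a <= u x - u b.
  have [Um m1 m2] := midT _ a4B.
  have := maxPhi (line x a4 2^-1) a4 x; rewrite lerBlDr.
  suff T' : T (line x a4 2^-1, a4, x) by move=> /(_ T'); lra.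
  by apply/TE; split; rewrite // 1?enormC //; apply: UK => //; exact: BU.
(* If the drop doubles at [b2], maximality against the triple with [x] and [b2] in place of [a] and
   [b] gives [u b - u b2 <= v a - v x]. *)
have QR : u x - u b <= Num.max (c * r) (v a - v x).
  rewrite le_max; have [-> //|[b2 b2B hb2]] := hu x r b r0 BU bx.
  have [Um m1 m2] := midT _ b2B.
  have T' : T (line x b2 2^-1, x, b2).
    by apply/TE; split; rewrite // 1?enormC //; apply: UK => //; exact: BU.
  by apply/orP; right; have := maxPhi _ _ _ T'; lra.
have QR' : u x - u b <= v a4 - v a.
  by apply: le_trans QR _; rewrite ge_max ha4 ha4'.
(* By [QR'] the triple with [a4] and [x] is maximal too, so the second maximisation applies to
   it. *)
have a4a : v a4 <= v a.
  have [Um m1 m2] := midT _ a4B.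
  apply: (maxv (line x a4 2^-1) a4 x); last by lra.
  by apply/TE; split; rewrite // 1?enormC //; apply: UK => //; exact: BU.
have crge : 0 <= c * r by rewrite mulr_ge0 // ltW.
(* All inequalities above are now equalities: [v x = v a] and [u x = u b]. So every centre within
   [r] of [x] belongs to a doubly maximal triple, and moving along [i0] contradicts the third
   maximisation. *)
pose x' := x + r *: delta_mx 0 i0.
have d1 : enorm (delta_mx 0 i0 : 'rV[R]_n) = 1.
  apply/eqP; rewrite -(@eqrXn2 _ 2) ?enorm_ge0 // enorm_sqr dot_delta mxE !eqxx.
  by rewrite expr1n.
have x'x : enorm (x' - x) = r.
  by rewrite /x' addrAC subrr add0r enormZ d1 mulr1 ger0_norm ?ltW.
have Ux' : U x' by apply: BU; rewrite /eball /= x'x; lra.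
have : x' 0 i0 <= x 0 i0.
  apply: (maxx x' x x); [|lra|lra].
  by apply/TE; split; rewrite ?(enormC x) ?x'x //; exact: UK.
rewrite /x' !mxE !eqxx mulr1; lra.
Qed.

End comparison.

(** * Differentiability *)

Section differentiability.
Context {R : realType} {n : nat}.
Implicit Types (U : set 'rV[R]_n) (h : 'rV[R]_n -> R) (x y p : 'rV[R]_n).

Definition has_gradient h x p := forall e, 0 < e ->
  exists2 d, 0 < d & forall y, enorm (y - x) < d ->
    `|h y - h x - dot p (y - x)| <= e * enorm (y - x).

Lemma differentiable_gradient h x : differentiable h x ->
  has_gradient h x (gradient h x).
Proof.
move=> dh e e0.
have dE v : 'd h x v = dot (gradient h x) v.
  rewrite [in LHS](row_sum_delta v) linear_sum; apply: eq_bigr => i _.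
  by rewrite linearZ /= -deriveE // mxE mulrC.
have /eqaddoP /(_ _ e0) := diff_locally dh.
move=> /near_enormP [d d0 hd]; exists d => // y yd.
have yd' : enorm (y - x - 0) < d by rewrite subr0.
have := hd _ yd'.
rewrite !fctE /= subrK dE opprD addrA => /le_trans; apply.
apply: ler_wpM2l (ltW e0) _ _ _; exact: norm_le_enorm.
Qed.

Lemma has_gradient_line h x y p t : has_gradient h (line x y t) p ->
  is_derive t (1 : R) (fun s => h (line x y s)) (dot p (y - x)).
Proof.
move=> hg.
have cv : (fun s => s^-1 *: (((fun s => h (line x y s)) \o shift t) (s *: (1 : R)) -
    h (line x y t))) @ 0^' --> dot p (y - x).
  apply/cvgrPdist_le => e e0.
  have m0 : 0 < enorm (y - x) + 1 by rewrite ltr_pwDr ?enorm_ge0.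
  have q0 : 0 < e / (enorm (y - x) + 1) by rewrite divr_gt0.
  have [d d0 hd] := hg _ q0.
  rewrite near_withinE; apply/nbhs_ballP; exists (d / (enorm (y - x) + 1)).
    by rewrite /= divr_gt0.
  move=> s; rewrite -ball_normE /= sub0r normrN => sd s0.
  have lE : enorm (line x y (s + t) - line x y t) = `|s| * enorm (y - x).
    by rewrite enorm_line addrK.
  have ld : enorm (line x y (s + t) - line x y t) < d.
    rewrite lE; rewrite ltr_pdivlMr // in sd; apply: le_lt_trans sd.
    by rewrite ler_wpM2l // lerDl.
  have := hd _ ld; rewrite lE.
  have -> : line x y (s + t) - line x y t = s *: (y - x).
    by rewrite /line scalerDl opprD addrA addrAC addrA addrK addrAC subrr add0r.
  rewrite dotZr /GRing.scale /= mulr1 => H.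
  have -> : dot p (y - x) - s^-1 * (h (line x y (s + t)) - h (line x y t)) =
      - s^-1 * (h (line x y (s + t)) - h (line x y t) - s * dot p (y - x)).
    by field.
  rewrite normrM normrN normfV mulrC ler_pdivrMr ?normr_gt0 //.
  apply: le_trans H _; rewrite mulrCA [leRHS]mulrC ler_wpM2l //.
  by rewrite mulrAC ler_pdivrMr // ler_wpM2l ?(ltW e0) // lerDl.
split; first by apply/cvg_ex; eexists; exact: cv.
exact: cvg_lim cv.
Qed.

Lemma gradient_le h x p r k : has_gradient h x p -> 0 < r -> 0 <= k ->
  (forall y, eball x r y -> h y <= h x + k * enorm (y - x)) -> enorm p <= k.
Proof.
move=> hg r0 k_ge0 hk; rewrite leNgt; apply/negP => kp.
have [|d d0 hd] := hg ((enorm p - k) / 2); first by rewrite divr_gt0 // subr_gt0.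
have [p0|pn0] := eqVneq (enorm p) 0.
  by move: kp; rewrite p0; lra.
have pp : 0 < enorm p by rewrite lt0r pn0 enorm_ge0.
pose t := Num.min (d / 2) r / enorm p.
have m0 : 0 < Num.min (d / 2) r by rewrite lt_min r0 divr_gt0.
have t0 : 0 < t by rewrite /t divr_gt0.
have tp : t * enorm p = Num.min (d / 2) r by rewrite /t divfK.
have yE : x + t *: p - x = t *: p by rewrite addrAC subrr add0r.
have ty : enorm (x + t *: p - x) = t * enorm p by rewrite yE enormZ gtr0_norm.
have td : enorm (x + t *: p - x) < d.
  by rewrite ty tp gt_min; apply/orP; left; lra.
have tr : eball x r (x + t *: p) by rewrite /eball /= ty tp ge_min lexx orbT.
have H1 := hd _ td; have H2 := hk _ tr.
rewrite ty yE dotZr -enorm_sqr in H1; rewrite ty in H2.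
move: H1; rewrite ler_norml => /andP[H1 _].
have : 0 < t * enorm p * (enorm p - k) by rewrite mulr_gt0 ?subr_gt0 // mulr_gt0.
lra.
Qed.

End differentiability.

(** * Ascent of infinity harmonic functions *)

Section ascent.
Context {R : realType} {n : nat}.
Implicit Types (U : set 'rV[R]_n) (h v : 'rV[R]_n -> R) (x y : 'rV[R]_n).

Lemma eball_argmax U v x r : {within U, continuous v} -> 0 <= r ->
  eball x r `<=` U ->
  exists2 y, eball x r y & forall z, eball x r z -> v z <= v y.
Proof.
move=> cv r0 BU; apply: compact_argmax; first exact: compact_eball.
  by exists x; exact: eball_center.
exact: continuous_subspaceW cv.
Qed.

Lemma cone_le_max U v x r y : {within U, continuous v} -> no_touching_above U 0 v ->
  0 < r -> eball x r `<=` U -> eball x r y ->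
  (forall z, eball x r z -> v z <= v y) ->
  forall z, eball x r z -> v z <= v x + (v y - v x) / r * enorm (z - x).
Proof.
move=> cv nt r0 BU yB ymax z zB.
have h0 : 0 <= v y - v x by rewrite subr_ge0 ymax //; exact/eball_center/ltW.
have k0 : 0 <= (v y - v x) / r by rewrite divr_ge0 // ltW.
have H z' : eball x r z' -> v z' <= v x + (v y - v x) / r * r.
  by move=> /ymax; rewrite divfK ?gt_eqF //; lra.
exact: comparison_with_cones nt (lexx 0) k0 r0 BU (continuous_subspaceW BU cv) H z zB.
Qed.

Lemma eball_line x y r t : eball x r y -> 0 <= t -> t <= 1 -> eball x r (line x y t).
Proof.
rewrite /eball /= => yB t0 t1; rewrite -[X in _ - X](line0 x y) enorm_line subr0.
by rewrite ger0_norm //; apply: le_trans yB; rewrite ler_piMl ?enorm_ge0.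
Qed.

Lemma enorm_line0 x y t : 0 <= t -> enorm (line x y t - x) = t * enorm (y - x).
Proof.
by move=> t0; rewrite -[X in _ - X](line0 x y) enorm_line subr0 ger0_norm.
Qed.

Lemma enorm_line1 x y t : t <= 1 -> enorm (line x y t - y) = (1 - t) * enorm (y - x).
Proof.
move=> t1; rewrite -[X in _ - X](line1 x y) enorm_line distrC ger0_norm //.
by rewrite subr_ge0.
Qed.

Lemma chord_le_max U v x r y t : {within U, continuous v} -> no_touching_above U 0 v ->
  0 < r -> eball x r `<=` U -> eball x r y ->
  (forall z, eball x r z -> v z <= v y) -> 0 <= t -> t <= 1 ->
  v (line x y t) <= v x + t * (v y - v x).
Proof.
move=> cv nt r0 BU yB ymax t0 t1.
have := cone_le_max cv nt r0 BU yB ymax (eball_line yB t0 t1).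
rewrite enorm_line0 // => /le_trans; apply; rewrite lerD2l mulrCA ler_wpM2l //.
rewrite mulrAC ler_pdivrMr // ler_wpM2l // subr_ge0 ymax //.
exact/eball_center/ltW.
Qed.

(** On the segment from [x] to the maximum point [y], [h] lies below its chord and agrees with it at
    [y]. Hence the derivative at [y] along the segment is at least the increment of the chord. *)
Lemma gradient_ge_max U h x r y : {within U, continuous h} ->
  no_touching_above U 0 h -> 0 < r -> eball x r `<=` U -> eball x r y ->
  (forall z, eball x r z -> h z <= h y) -> differentiable h y ->
  h y - h x <= enorm (gradient h y) * r.
Proof.
move=> ch nt r0 BU yB ymax dh; apply/ler_addgt0Pr => e e0.
have er0 : 0 < e / r by rewrite divr_gt0.
have [d d0 hd] := differentiable_gradient dh er0.
(* A step back from [y] by this fraction of the segment satisfies [s < 1] and [s * r < d]. *)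
have q0 : 0 < d / (d + r) by rewrite divr_gt0 // addr_gt0.
set s := d / (d + r) in q0.
have s1 : s < 1 by rewrite /s ltr_pdivrMr ?addr_gt0 // mul1r ltrDl.
have sd : s * r < d.
  by rewrite /s mulrAC ltr_pdivrMr ?addr_gt0 //; nra.
have yr : enorm (y - x) <= r by [].
have lE : enorm (line x y (1 - s) - y) = s * enorm (y - x).
  by rewrite enorm_line1; [congr (_ * _); ring|lra].
have ld : enorm (line x y (1 - s) - y) < d.
  by rewrite lE; apply: le_lt_trans sd; rewrite ler_wpM2l // ltW.
have := hd _ ld; rewrite lE.
have -> : line x y (1 - s) - y = - (s *: (y - x)).
  by apply/rowP => i; rewrite /line !mxE; ring.
have chord : h (line x y (1 - s)) <= h x + (1 - s) * (h y - h x).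
  by apply: chord_le_max ch nt r0 BU yB ymax _ _; lra.
rewrite dotNr dotZr ler_norml => /andP[H _].
have D := dot_le (gradient h y) (y - x).
have g0 := enorm_ge0 (gradient h y).
have D' : enorm (gradient h y) * enorm (y - x) <= enorm (gradient h y) * r.
  by rewrite ler_wpM2l.
have E' : e / r * enorm (y - x) <= e.
  by rewrite mulrAC ler_pdivrMr // ler_wpM2l // ltW.
rewrite -(ler_pM2l q0).
have : s * dot (gradient h y) (y - x) <= s * (enorm (gradient h y) * r).
  by rewrite ler_wpM2l ?(ltW q0) //; lra.
have : e / r * (s * enorm (y - x)) <= s * e.
  by rewrite mulrCA ler_wpM2l // ltW.
nra.
Qed.

Lemma gradient_le_max U h x r y : {within U, continuous h} ->
  no_touching_above U 0 h -> 0 < r -> eball x r `<=` U -> eball x r y ->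
  (forall z, eball x r z -> h z <= h y) -> differentiable h x ->
  enorm (gradient h x) <= (h y - h x) / r.
Proof.
move=> ch nt r0 BU yB ymax dh.
have h0 : 0 <= h y - h x by rewrite subr_ge0 ymax //; exact/eball_center/ltW.
have k0 : 0 <= (h y - h x) / r by rewrite divr_ge0 // ltW.
exact: gradient_le (differentiable_gradient dh) r0 k0
  (cone_le_max ch nt r0 BU yB ymax).
Qed.

Definition infinity_smooth U h :=
  [/\ open U, {within U, continuous h}, no_touching_above U 0 h &
      forall x, U x -> differentiable h x].

(** At a maximum point [y] over the ball, |Dh(x)| <= (h(y) - h(x)) / r <= |Dh(y)|, so |Dh| does not
    decrease along steepest ascent. *)
Lemma small_gradient_ascent U h x r : infinity_smooth U h ->
  ~ small_gradient_set U h x -> 0 < r -> eball x r `<=` U ->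
  exists y, [/\ eball x r y, ~ small_gradient_set U h y, h x + r <= h y &
    forall z, eball x r z -> h z <= h y].
Proof.
move=> [oU ch nt dh] nAx r0 BU.
have Ux : U x by apply/BU/eball_center/ltW.
have [y yB ymax] := eball_argmax ch (ltW r0) BU.
have gx : 1 <= enorm (gradient h x).
  by rewrite leNgt; apply/negP => g1; apply: nAx.
have k1 := le_trans gx (gradient_le_max ch nt r0 BU yB ymax (dh _ Ux)).
rewrite ler_pdivlMr // mul1r in k1.
exists y; split => //; last by lra.
move=> [_ gy]; have := gradient_ge_max ch nt r0 BU yB ymax (dh _ (BU _ yB)).
nra.
Qed.

Lemma open_eball U x : open U -> U x -> exists2 r, 0 < r & eball x r `<=` U.
Proof.
move=> /open_enormP oU /oU [e e0 he]; exists (e / 2); first by rewrite divr_gt0.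
by move=> y; rewrite /eball /= => yx; apply: he; lra.
Qed.

(** Since [h] is only assumed differentiable, |Dh| is controlled through slopes over balls. The
    expansion at [x] bounds the increments on a fixed ball, and the maximal slope over a slightly
    smaller ball about [y] bounds |Dh(y)|. *)
Lemma open_small_gradient_set U h : infinity_smooth U h ->
  open (small_gradient_set U h).
Proof.
move=> [oU ch nt dh]; apply/open_enormP => x [Ux g1].
set g := enorm (gradient h x) in g1.
have g0 : 0 <= g := enorm_ge0 _.
pose c := (1 + g) / 2.
have c0 : 0 < c - g by rewrite /c; lra.
have c1 : c < 1 by rewrite /c; lra.
have [d d0 hd] := differentiable_gradient (dh _ Ux) c0.
have [r1 r10 hr1] := open_eball oU Ux.
pose r := Num.min r1 (d / 2).
have r0 : 0 < r by rewrite lt_min r10 divr_gt0.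
have BU : eball x r `<=` U.
  by apply: subset_trans hr1 => y /le_trans; apply; rewrite ge_min lexx.
have rd : r < d by rewrite gt_min; apply/orP; right; lra.
have hc y : eball x r y -> `|h y - h x| <= c * enorm (y - x).
  move=> yB; have := hd y (le_lt_trans yB rd).
  have := dot_le (gradient h x) (y - x); have := dot_le (- gradient h x) (y - x).
  rewrite dotNl enormN -/g !ler_norml => ? ? /andP[? ?].
  by apply/andP; split; lra.
pose rho := r * (1 - c) / 4.
have rho0 : 0 < rho by rewrite /rho !mulr_gt0 // ?invr_gt0 // subr_gt0.
have rho_r : rho < r by rewrite /rho; nra.
exists rho => // y yx.
have yB : eball x r y by apply: ltW; exact: lt_trans rho_r.
split; first exact: BU.
have r'0 : 0 < r - rho by rewrite subr_gt0.
have B'B : eball y (r - rho) `<=` eball x r.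
  by move=> z; rewrite /eball /= => zy; have := enorm_triangle z y x; lra.
have B'U := subset_trans B'B BU.
have [z zB zmax] := eball_argmax ch (ltW r'0) B'U.
apply: le_lt_trans (gradient_le_max ch nt r'0 B'U zB zmax (dh _ (BU _ yB))) _.
rewrite ltr_pdivrMr // mul1r.
have zx : enorm (z - x) <= r by exact: B'B.
have := hc _ (B'B _ zB); have := hc _ yB.
rewrite !ler_norml => /andP[? ?] /andP[? ?].
have cr : c * enorm (z - x) <= c * r by rewrite ler_wpM2l //; lra.
have cr' : c * enorm (y - x) <= c * rho by rewrite ler_wpM2l // ?(ltW yx) //; lra.
rewrite /rho in cr' *; nra.
Qed.

(** The mean value theorem is applied on the part of the segment before [y]; the end point, which
    may lie outside [U], is reached by continuity on [K]. *)
Lemma lipschitz_small_gradient K U h x y : infinity_smooth U h ->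
  {within K, continuous h} -> U `<=` K -> K y ->
  (forall t, 0 <= t -> t < 1 -> small_gradient_set U h (line x y t)) ->
  h y - enorm (y - x) <= h x.
Proof.
move=> [oU ch nt dh] cK UK Ky hA.
have H (s : R) : 0 <= s -> s < 1 -> h (line x y s) <= h x + enorm (y - x).
  move=> s0 s1.
  have dline (t : R) : 0 <= t -> t < 1 -> is_derive t (1 : R) (fun s => h (line x y s))
      (dot (gradient h (line x y t)) (y - x)).
    move=> t0 t1; apply: has_gradient_line.
    by apply/differentiable_gradient/dh; have [] := hA _ t0 t1.
  have [|t|c] := @MVT_segment _ (fun s => h (line x y s))
      (fun t => dot (gradient h (line x y t)) (y - x)) 0 s s0.
  - by move=> t; rewrite in_itv /= => /andP[t0 ts]; apply: dline; lra.
  - apply: derivable_within_continuous => t'; rewrite in_itv /= => /andP[t0 ts].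
    by have [] := dline t' t0 (le_lt_trans ts s1).
  rewrite in_itv /= => /andP[c0 cs]; rewrite line0 subr0 => E.
  have [_ gc] := hA _ c0 (le_lt_trans cs s1).
  have := dot_le (gradient h (line x y c)) (y - x).
  have := enorm_ge0 (y - x); have := enorm_ge0 (gradient h (line x y c)).
  set G := enorm (gradient _ _) in gc *; set D := enorm (y - x).
  move=> G0 D0 GD; have : G * D <= D by rewrite ler_piMl // ltW.
  move: E; set q := dot _ _ in GD *; nra.
rewrite lerBlDr; apply/ler_addgt0Pr => e e0.
have [d d0 hd] := (within_continuous_enormP _ _).1 cK _ Ky _ e0.
pose s := Num.min (2^-1) (d / (2 * (enorm (y - x) + 1))).
have m0 : 0 < enorm (y - x) + 1 by rewrite ltr_pwDr ?enorm_ge0.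
have s0 : 0 < s by rewrite lt_min invr_gt0 ltr0n divr_gt0 // mulr_gt0.
have s12 : s <= 2^-1 by rewrite ge_min lexx.
have sd : s * enorm (y - x) < d.
  have : s <= d / (2 * (enorm (y - x) + 1)) by rewrite ge_min lexx orbT.
  rewrite ler_pdivlMr ?mulr_gt0 //; nra.
have s1 : 1 - s < 1 by lra.
have s10 : 0 <= 1 - s by lra.
have [Ul _] := hA _ s10 s1.
have := hd (line x y (1 - s)) (UK _ Ul).
rewrite enorm_line1 ?(ltW s1) // (_ : 1 - (1 - s) = s); last by ring.
move=> /(_ sd); rewrite ltr_norml => /andP[H1 _].
by have := H _ s10 s1; lra.
Qed.

End ascent.

(** * The patched function *)

Section patching.
Context {R : realType} {n : nat} (U A : set 'rV[R]_n) (h : 'rV[R]_n -> R).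
Implicit Types (x y : 'rV[R]_n) (r v : R).

(** The end point is left out, so that a path in [A] may end at its first point outside. *)
Definition segment_in x y := forall t : R, 0 <= t -> t < 1 -> A (line x y t).

(* [chain x v] says that v is h(y) minus the length of a polygonal line from x to
   a point y outside A, all of whose other points are in A. *)
Inductive chain : 'rV[R]_n -> R -> Prop :=
| chain_end y : closure U y -> ~ A y -> chain y (h y)
| chain_step x y v : segment_in x y -> chain y v -> chain x (v - enorm (y - x)).

(** In [A] this is the lower McShane-Whitney extension, for the path metric of [A], of the values of
    [h] outside [A]. *)
Definition patch x := sup [set v | chain x v].

Context (oA : open A) (AU : A `<=` U) (outside : exists y, ~ A y)
  (ch : {within closure U, continuous h})
  (lip : forall x y, closure U y -> segment_in x y -> h y - enorm (y - x) <= h x)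
  (asc : forall x r, ~ A x -> 0 < r -> eball x r `<=` U ->
    exists y, [/\ eball x r y, ~ A y, h x + r <= h y &
      forall z, eball x r z -> h z <= h y]).

Lemma segment_in_left x y : segment_in x y -> A x.
Proof. by move=> /(_ 0 (lexx 0) ltr01); rewrite line0. Qed.

Lemma line_sub x y s t : line x (line x y s) t = line x y (t * s).
Proof. by apply/rowP => i; rewrite /line !mxE; ring. Qed.

Lemma segment_in_suffix x y s : 0 <= s -> s < 1 -> segment_in x y ->
  segment_in (line x y s) y.
Proof. by move=> s0 s1 xy t t0 t1; rewrite line_line; apply: xy; nra. Qed.

Lemma segment_in_closure x y : segment_in x y -> closure U y.
Proof.
move=> xy; rewrite -(line1 x y); apply: closure_exit ltr01 _ => t t0 t1.
exact/AU/xy.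
Qed.

Lemma exit_segment x y : A x -> ~ A y -> exists s, [/\ 0 < s, s <= 1,
  ~ A (line x y s) & segment_in x (line x y s)].
Proof.
move=> Ax nAy; have [s [s0 s1 nAs hs]] := first_exit oA Ax nAy.
exists s; split => // t t0 t1; rewrite line_sub; apply: hs; nra.
Qed.

Lemma chain_le x v : chain x v -> v <= h x.
Proof.
elim=> {x v} [x|x y v xy _ IH] //.
by have := lip (segment_in_closure xy) xy; lra.
Qed.

Lemma chain_exists x : closure U x -> exists v, chain x v.
Proof.
move=> Kx; have [Ax|nAx] := pselect (A x); last by exists (h x); exact: chain_end.
have [y nAy] := outside; have [s [_ _ nAs xs]] := exit_segment Ax nAy.
exists (h (line x y s) - enorm (line x y s - x)).
by apply: (chain_step xs); apply: chain_end => //; exact: segment_in_closure xs.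
Qed.

Lemma chain_closure x v : chain x v -> closure U x.
Proof.
by case=> // {}x y {}v /segment_in_left Ax _; exact/subset_closure/AU.
Qed.

Lemma chain_has_sup x : closure U x -> has_sup [set v | chain x v].
Proof.
move=> Kx; split; first exact: chain_exists.
by exists (h x) => v; exact: chain_le.
Qed.

Lemma le_patch x v : chain x v -> v <= patch x.
Proof.
move=> xv; apply: ub_le_sup => //; first by have [] := chain_has_sup (chain_closure xv).
Qed.

Lemma patch_le_ub x c : closure U x -> (forall v, chain x v -> v <= c) -> patch x <= c.
Proof. by move=> Kx hc; apply: ge_sup => //; exact: chain_exists. Qed.

Lemma patch_le x : closure U x -> patch x <= h x.
Proof. by move=> Kx; apply: patch_le_ub => // v; exact: chain_le. Qed.

Lemma patch_notin x : closure U x -> ~ A x -> patch x = h x.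
Proof.
by move=> Kx nAx; apply/eqP; rewrite eq_le patch_le //= le_patch //; exact: chain_end.
Qed.

Lemma patch_step x y : segment_in x y -> patch y - enorm (y - x) <= patch x.
Proof.
move=> xy; rewrite lerBlDr; apply: patch_le_ub; first exact: segment_in_closure xy.
by move=> v yv; rewrite -lerBlDr; apply: le_patch; exact: chain_step xy yv.
Qed.

(** On balls inside [A] the function is 1-Lipschitz by [patch_step]. Near a point outside [A] it is
    squeezed between [h] and the value of [h] at the exit point minus the distance to it. *)
Lemma within_continuous_patch : {within closure U, continuous patch}.
Proof.
apply/within_continuous_enormP => x Kx e e0.
have [Ax|nAx] := pselect (A x).
  have [d d0 hd] := (open_enormP _).1 oA _ Ax.
  have seg y z : enorm (y - x) < d -> enorm (z - x) < d -> segment_in y z.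
    move=> yx zx t t0 t1; apply: hd.
    have -> : line y z t - x = (1 - t) *: (y - x) + t *: (z - x).
      by apply/rowP => i; rewrite /line !mxE; ring.
    apply: le_lt_trans (enormD _ _) _; rewrite !enormZ !ger0_norm; nra.
  exists (Num.min d e); first by rewrite lt_min d0.
  move=> y Ky; rewrite lt_min => /andP[yd ye].
  have xd : enorm (x - x) < d by rewrite subrr enorm0.
  have := patch_step (seg _ _ yd xd); have := patch_step (seg _ _ xd yd).
  by rewrite (enormC x y) ltr_norml => ? ?; apply/andP; split; lra.
have e20 : 0 < e / 2 by rewrite divr_gt0.
have [d d0 hd] := (within_continuous_enormP _ _).1 ch _ Kx _ e20.
exists (Num.min d (e / 2)); first by rewrite lt_min d0.
move=> y Ky; rewrite lt_min => /andP[yd ye]; rewrite (patch_notin Kx nAx).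
have [Ay|nAy] := pselect (A y); last first.
  by rewrite (patch_notin Ky nAy); apply: lt_le_trans (hd _ Ky yd) _; lra.
have [s [s0 s1 nAs ys]] := exit_segment Ay nAx.
have Kq := segment_in_closure ys.
have qx : enorm (line y x s - x) <= enorm (y - x).
  by rewrite enorm_line1 // (enormC x y); have := enorm_ge0 (y - x); nra.
have qy : enorm (line y x s - y) <= enorm (y - x).
  by rewrite enorm_line0 ?(ltW s0) // (enormC x y); have := enorm_ge0 (y - x); nra.
have := hd _ Kq (le_lt_trans qx yd); have := hd _ Ky yd.
have := patch_step ys; rewrite (patch_notin Kq nAs); have := patch_le Ky.
by rewrite !ltr_norml => ? ? /andP[? ?] /andP[? ?]; apply/andP; split; lra.
Qed.

(** Walking along the chain raises the value of the remaining chain by the length covered. If the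
    chain ends before length [r], the ascent [asc] of [h] covers the rest. *)
Lemma chain_ascent x v r : chain x v -> 0 <= r -> eball x r `<=` U ->
  exists2 y, eball x r y & v + r <= patch y.
Proof.
move=> xv; elim: xv r => {x v} [x Kx nAx r r0 BU|x y v xy yv IH r r0 BU].
  have [->|rn0] := eqVneq r 0.
    by exists x; [exact: eball_center|rewrite addr0 patch_notin].
  have [|y [yB nAy hy _]] := asc nAx _ BU; first by rewrite lt0r rn0.
  by exists y => //; rewrite patch_notin //; exact/subset_closure/BU.
have [tr|rt] := leP (enorm (y - x)) r.
  have [||z zB hz] := IH (r - enorm (y - x)); first by rewrite subr_ge0.
    move=> z; rewrite /eball /= => zy; apply: BU; rewrite /eball /=.
    by have := enorm_triangle z y x; lra.
  exists z; last by lra.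
  by move: zB; rewrite /eball /= => zB; have := enorm_triangle z y x; lra.
have d0 : 0 < enorm (y - x) by exact: le_lt_trans rt.
pose s := r / enorm (y - x).
have s0 : 0 <= s by rewrite divr_ge0 // ltW.
have s1 : s < 1 by rewrite ltr_pdivrMr // mul1r.
have sr : s * enorm (y - x) = r by rewrite /s divfK // gt_eqF.
exists (line x y s); first by rewrite /eball /= enorm_line0 // sr.
apply: le_trans (le_patch (chain_step (segment_in_suffix s0 s1 xy) yv)).
by rewrite (enormC y (line x y s)) enorm_line1 ?(ltW s1) // mulrBl sr; lra.
Qed.

Lemma patch_slope : slope_ge 1 U patch.
Proof.
move=> x r r0 BU.
have cB : {within U, continuous patch}.
  exact: continuous_subspaceW (@subset_closure _ U) within_continuous_patch.
have [y yB ymax] := eball_argmax cB (ltW r0) BU.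
exists y => //; rewrite mul1r -lerBrDr; apply: patch_le_ub.
  by apply/subset_closure/BU/eball_center/ltW.
move=> v xv; have [z zB hz] := chain_ascent xv (ltW r0) BU.
by have := ymax _ zB; lra.
Qed.

(** Increments up to [r] are doubled by [patch_slope]. For a larger one the segment from [x] to [a]
    must meet the complement of [A], at a point [y] say; the ascent of [h] from [y] over radius
    [2 * r - tau] supplies [b], and cone comparison about [y] bounds the value at [a]. *)
Lemma patch_doubling : {within U, continuous h} -> no_touching_above U 0 h ->
  doubling U patch.
Proof.
move=> cU nt x r a r0 BU aB.
have r20 : 0 < 2 * r by rewrite mulr_gt0.
have [small|large] := leP (patch a - patch x) r.
  have [b bB hb] := patch_slope r20 BU; exists b => //; lra.
have Kx : closure U x by apply/subset_closure/BU/eball_center/ltW.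
have aB2 : eball x (2 * r) a by apply: le_trans aB _; lra.
have Ka : closure U a by exact/subset_closure/BU.
have [tau [y [yx tau0 yE nAy hy]]] : exists tau y, [/\ enorm (y - x) = tau,
    tau < r, enorm (a - y) <= r - tau, ~ A y & h y - patch x <= tau].
  have [Ax|nAx] := pselect (A x); last first.
    exists 0, x; rewrite subrr enorm0 subr0; split => //.
    by rewrite patch_notin // subrr.
  have [xa|] := pselect (segment_in x a).
    have := patch_step xa; move: aB; rewrite /eball /=; lra.
  move=> /existsNP [t /not_implyP[t0 /not_implyP[t1 nAt]]].
  have [s [s0 s1 nAs xs]] := exit_segment Ax nAt.
  rewrite line_sub in nAs xs; have {s0 s1} [s0 s1] : 0 <= s * t /\ s * t < 1.
    by split; [rewrite mulr_ge0 // ltW|nra].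
  set q := s * t in nAs xs s0 s1.
  exists (enorm (line x a q - x)), (line x a q); split => //.
  - rewrite enorm_line0 //; apply: le_lt_trans (_ : q * r < r).
      by rewrite ler_wpM2l.
    by rewrite gtr_pMl.
  - rewrite enormC enorm_line0 // enorm_line1 ?(ltW s1) // mulrBl mul1r.
    by rewrite lerD2r.
  - have := patch_step xs; rewrite patch_notin //; first lra.
    exact: segment_in_closure xs.
have R0 : 0 < 2 * r - tau by lra.
have BB : eball y (2 * r - tau) `<=` eball x (2 * r).
  by move=> z; rewrite /eball /= => zy; have := enorm_triangle z y x; lra.
have B'U := subset_trans BB BU.
have [b [bB nAb hb bmax]] := asc nAy R0 B'U.
have Kb : closure U b by exact/subset_closure/B'U.
exists b; first exact: BB.
have aB' : eball y (2 * r - tau) a by apply: le_trans yE _; lra.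
have := cone_le_max cU nt R0 B'U bB bmax aB'.
have := patch_le Ka; rewrite (patch_notin Kb nAb).
have hb0 : 0 <= h b - h y by lra.
have cone : (h b - h y) / (2 * r - tau) * enorm (a - y) <=
    (h b - h y) / (2 * r - tau) * (r - tau).
  by rewrite ler_wpM2l // divr_ge0 // ltW.
move=> pa cn; have {pa cn cone} :
    patch a <= h y + (h b - h y) / (2 * r - tau) * (r - tau).
  lra.
(* Let S be the slope [(h b - h y) / (2 * r - tau)]. The goal reduces to [h y - patch x <= S * tau],
   which holds because the left side is at most [tau] and S >= 1 by [hb]. *)
rewrite -lerBlDl mulrAC ler_pdivlMr // => main.
have tau_ge0 : 0 <= tau by rewrite -yx enorm_ge0.
rewrite -(ler_pM2r (_ : 0 < r - tau)); last by rewrite subr_gt0.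
nra.
Qed.

End patching.

(** * Ascending sequences *)

Section ascending_sequences.
Context {R : realType} {n : nat}.
Implicit Types (U V A : set 'rV[R]_n) (u p : 'rV[R]_n -> R) (x y : 'rV[R]_n).

Definition ascends U u y := forall r, 0 < r -> eball y r `<=` U ->
  exists2 z, eball y r z & u y + r <= u z.

(** By cone comparison the maximal slope over balls about [x] is nondecreasing in the radius, so
    slope 1 on a small ball in [V] persists on every larger ball in [U]. *)
Lemma ascends_subdomain U V u x : {within U, continuous u} ->
  no_touching_above U 0 u -> open V -> slope_ge 1 V u -> V x -> ascends U u x.
Proof.
move=> cu nt oV sV Vx r r0 BU.
have [r1 r10 hr1] := open_eball oV Vx.
pose s := Num.min r r1.
have s0 : 0 < s by rewrite lt_min r0.
have sr : s <= r by rewrite ge_min lexx.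
have BV : eball x s `<=` V.
  by apply: subset_trans hr1 => z /le_trans; apply; rewrite ge_min lexx orbT.
have [y yB hy] := sV _ _ s0 BV.
have [z zB zmax] := eball_argmax cu (ltW r0) BU.
exists z => //; have yB' : eball x r y by exact: le_trans sr.
have h0 : 0 <= u z - u x by rewrite subr_ge0 zmax //; exact/eball_center/ltW.
have := cone_le_max cu nt r0 BU zB zmax yB'.
have : (u z - u x) / r * enorm (y - x) <= (u z - u x) / r * s.
  by rewrite ler_wpM2l // divr_ge0 // ltW.
move=> h1 h2; have : s <= (u z - u x) / r * s by lra.
rewrite -[X in X <= _]mul1r ler_pM2r // ler_pdivlMr // mul1r; lra.
Qed.

(** A discrete form of the monotonicity of |Du|, free of differentiability. From a point [q] just
    before [y] on the segment from [x], the chord bound gives slope at least 1 up to [y]; cone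
    comparison about [q] extends it to almost the whole ball about [y], and [q] tends to [y]. *)
Lemma ascends_max U u x r y : {within U, continuous u} ->
  no_touching_above U 0 u -> open U -> 0 < r -> eball x r `<=` U ->
  eball x r y -> (forall z, eball x r z -> u z <= u y) -> u x + r <= u y ->
  ascends U u y.
Proof.
move=> cu nt oU r0 BU yB ymax hy rho rho0 B'U.
have [z zB zmax] := eball_argmax cu (ltW rho0) B'U.
exists z => //; apply/ler_addgt0Pr => e e0.
have e20 : 0 < e / 2 by rewrite divr_gt0.
have [d d0 hd] := (within_continuous_enormP _ _).1 cu _ (BU _ yB) _ e20.
(* The step back is at most [l * r < m / 2]. The lost radius and the change of [u] between [q] and
   [y] then cost less than [e / 2] each. *)
pose m := Num.min (Num.min d e) rho.
have m0 : 0 < m by rewrite !lt_min d0 e0.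
pose l := m / (2 * (r + m)).
have rm0 : 0 < r + m by rewrite addr_gt0.
have l0 : 0 < l by rewrite divr_gt0 // mulr_gt0.
have lr : 2 * (l * r) < m.
  rewrite /l (_ : 2 * (m / (2 * (r + m)) * r) = m * (r / (r + m))).
    by rewrite gtr_pMr // ltr_pdivrMr // mul1r ltrDl.
  by field; rewrite gt_eqF.
have l1 : l <= 1.
  by rewrite ler_pdivrMr ?mulr_gt0 // mul1r; lra.
have [md [me mrho]] : m <= d /\ m <= e /\ m <= rho.
  by rewrite !ge_min !lexx !orbT.
have lr0 : 0 < l * r by rewrite mulr_gt0.
set q := line x y (1 - l).
have qy : enorm (q - y) <= l * r.
  rewrite /q enorm_line1; last by lra.
  by rewrite (_ : 1 - (1 - l) = l) ?ler_wpM2l ?(ltW l0) //; ring.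
have qB : eball x r q by apply: eball_line => //; lra.
have uq : u q <= u x + (1 - l) * (u y - u x).
  by apply: chord_le_max cu nt r0 BU yB ymax _ _; lra.
have s0 : 0 < rho - l * r by lra.
have BB : eball q (rho - l * r) `<=` eball y rho.
  by move=> w; rewrite /eball /= => wq; have := enorm_triangle w q y; lra.
have hq w : eball q (rho - l * r) w ->
    u w <= u q + (u z - u q) / (rho - l * r) * (rho - l * r).
  by move=> /BB /zmax; rewrite divfK ?gt_eqF //; lra.
have qz : 0 <= u z - u q by rewrite subr_ge0; apply/zmax/BB/eball_center/ltW.
have k0 : 0 <= (u z - u q) / (rho - l * r) by rewrite divr_ge0 // ltW.
have yq : eball q (rho - l * r) y by rewrite /eball /= enormC; lra.
have B''U := subset_trans BB B'U.
have := comparison_with_cones nt (lexx 0) k0 s0 B''U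
  (continuous_subspaceW B''U cu) hq yq.
have : (u z - u q) / (rho - l * r) * enorm (y - q) <=
    (u z - u q) / (rho - l * r) * (l * r).
  by rewrite ler_wpM2l // enormC.
move=> h1 h2.
have h3 : l * r <= (u z - u q) / (rho - l * r) * (l * r) by nra.
have h4 : rho - l * r <= u z - u q.
  by move: h3; rewrite -[X in X <= _]mul1r ler_pM2r // ler_pdivlMr // mul1r.
have : `|u q - u y| < e / 2 by apply: hd; [exact: BU|lra].
by rewrite ltr_norml => /andP[? ?]; lra.
Qed.

(** If [u - p] were positive at [x0], it would not decrease along ascent steps: [u] gains at least
    [r] and [p] at most [r]. As it is nonpositive outside [A], uniform continuity keeps the sequence
    at distance at least [r] from the complement, and [u] would be unbounded. *)
Lemma le_of_ascends U A u p : open U -> bounded_set U -> open A -> A `<=` U ->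
  {within closure U, continuous u} -> {within closure U, continuous p} ->
  no_touching_above U 0 u ->
  (forall x, closure U x -> ~ A x -> u x <= p x) ->
  (forall x y, segment_in A x y -> p y - enorm (y - x) <= p x) ->
  forall x, A x -> ascends U u x -> u x <= p x.
Proof.
move=> oU bU oA AU cu cp nt nA pA x0 Ax0 asc0; rewrite leNgt; apply/negP => gt0.
have cK := compact_closure_bounded bU.
have UK : U `<=` closure U := @subset_closure _ U.
have cuU := continuous_subspaceW UK cu.
pose g x := u x - p x.
have cg : {within closure U, continuous g}.
  by move=> x; apply: cvgB; [exact: cu|exact: cp].
have dl0 : 0 < g x0 by rewrite subr_gt0.
have [r1 r10 hr1] := within_continuous_compact_uniform cK cg dl0.
pose r := r1 / 2.
have r0 : 0 < r by rewrite divr_gt0.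
have BA y : A y -> g x0 <= g y -> eball y r `<=` A.
  move=> Ay gy z zB; apply: contrapT => nAz.
  have [s [s0 s1 nAs ys]] := exit_segment oA Ay nAz.
  have Kq := segment_in_closure AU ys.
  have : g y - g (line y z s) < g x0.
    apply: hr1 => //; first exact/UK/AU.
    have := eball_line zB (ltW s0) s1; rewrite /eball /= enormC /r; lra.
  have : g (line y z s) <= 0 by rewrite subr_le0 nA.
  lra.
have seq k : exists y, [/\ A y, ascends U u y, g x0 <= g y &
    u x0 + k%:R * r <= u y].
  elim: k => [|k [y [Ay ay gy uy]]]; first by exists x0; rewrite mul0r addr0.
  have By := BA _ Ay gy; have BU := subset_trans By AU.
  have [z zB zmax] := eball_argmax cuU (ltW r0) BU.
  have [z' z'B hz'] := ay _ r0 BU.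
  have uz : u y + r <= u z by apply: le_trans hz' (zmax _ z'B).
  exists z; split; first exact: (By _ zB).
  - exact: ascends_max cuU nt oU r0 BU zB zmax uz.
  - have yz : segment_in A y z.
      by move=> t t0 t1; apply/By/eball_line => //; exact: ltW.
    have zr : enorm (z - y) <= r by [].
    by have := pA _ _ yz; move: gy; rewrite /g; lra.
  - by rewrite -natr1 mulrDl mul1r; lra.
have [m _ hm] := compact_argmax cK (ex_intro _ x0 (UK _ (AU _ Ax0))) cu.
pose k := Num.bound `|(u m - u x0) / r|.
have [y [Ay _ _ uy]] := seq k.
have := hm _ (UK _ (AU _ Ay)).
have : (u m - u x0) / r < k%:R.
  by apply: le_lt_trans (ler_norm _) _; exact: archi_boundP.
rewrite ltr_pdivrMr //; lra.
Qed.

End ascending_sequences.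

(** * Second-order expansions *)

Section taylor.
Context {R : realType} {n : nat}.
Implicit Types (U : set 'rV[R]_n) (u phi : 'rV[R]_n -> R) (x y p : 'rV[R]_n).

Lemma enorm_le_coord p (q : 'rV[R]_n) :
  (forall i, `|p 0 i| <= `|q 0 i|) -> enorm p <= enorm q.
Proof.
move=> pq; rewrite enorm_le ?enorm_ge0 // enorm_sqr; apply: ler_sum => i _.
by rewrite -!expr2 -ler_sqrt ?sqr_ge0 // !sqrtr_sqr.
Qed.

Lemma mean_value (f df : R -> R) b :
  (forall t, `|t| <= `|b| -> is_derive t (1 : R) f (df t)) ->
  exists2 c, `|c| <= `|b| & f b - f 0 = df c * b.
Proof.
move=> fd.
have mvt (x y : R) : x <= y -> (forall t, x <= t <= y -> `|t| <= `|b|) ->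
    exists2 c, x <= c <= y & f y - f x = df c * (y - x).
  move=> xy hb.
  have H1 t : t \in `]x, y[%R -> is_derive t (1 : R) f (df t).
    rewrite in_itv /= => /andP[xt ty]; apply/fd/hb.
    by rewrite (ltW xt) (ltW ty).
  have H2 : {within `[x, y], continuous f}.
    apply: derivable_within_continuous => t; rewrite in_itv /= => xty.
    by have [] := fd _ (hb _ xty).
  have [c cxy E] := MVT_segment xy H1 H2.
  by exists c => //; move: cxy; rewrite in_itv.
have [b0|b0] := leP 0 b.
  have [|c cb E] := mvt 0 b b0.
    by move=> t /andP[t0 tb]; rewrite !ger0_norm.
  by exists c; [move: cb => /andP[? ?]; rewrite !ger0_norm|rewrite E subr0].
have [|c cb E] := mvt b 0 (ltW b0).
  by move=> t /andP[tb t0]; rewrite !ler0_norm ?lerN2 // ltW.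
exists c; last by lra.
by move: cb => /andP[cb c0]; rewrite !ler0_norm ?lerN2 // ltW.
Qed.

Lemma is_derive_translate phi x v t : derivable phi (x + t *: v) v ->
  is_derive t (1 : R) (fun s => phi (x + s *: v)) ('D_v phi (x + t *: v)).
Proof.
have E : (fun s => s^-1 *: (((fun s => phi (x + s *: v)) \o shift t) (s *: (1 : R)) -
     phi (x + t *: v))) =
    (fun s => s^-1 *: ((phi \o shift (x + t *: v)) (s *: v) - phi (x + t *: v))).
  apply/funext => s /=; congr (_ *: (phi _ - _)).
  by rewrite [_%:A]mulr1 scalerDl addrCA.
move=> d; split; first by rewrite /derivable E.
by rewrite /derive E.
Qed.

(** [C1_on] speaks of partial derivatives, so [x] is moved to [y] one coordinate at a time through
    the points [F k], with the mean value theorem on each leg. *)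
Lemma C1_has_gradient U phi x : open U -> C1_on U phi -> U x ->
  has_gradient phi x (gradient phi x).
Proof.
move=> oU [_ dphi cphi] Ux e e0.
pose e' := e / n.+1%:R; have e'0 : 0 < e' by rewrite divr_gt0.
have [r r0 hr] := (open_enormP _).1 oU _ Ux.
have near_i i : \forall y \near x, `|partial i phi y - partial i phi x| < e'.
  apply/near_enormP; have /continuous_enormP := cphi i _ Ux.
  exact.
have /near_enormP [d d0 hd] : \forall y \near x, forall i,
    `|partial i phi y - partial i phi x| < e' by exact: filter_forall near_i.
exists (Num.min d r); first by rewrite lt_min d0.
move=> y; rewrite lt_min => /andP[yd yr].
pose F (k : nat) : 'rV[R]_n := \row_i (if (i < k)%N then y 0 i else x 0 i).
have F0 : F 0%N = x by apply/rowP => i; rewrite mxE.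
have Fn : F n = y by apply/rowP => i; rewrite mxE ltn_ord.
have sumE : phi y - phi x - dot (gradient phi x) (y - x) =
    \sum_(k < n) (phi (F k.+1) - phi (F k) - partial k phi x * (y - x) 0 k).
  rewrite big_split /= sumrN -(big_mkord xpredT (fun k => phi (F k.+1) - phi (F k))).
  rewrite telescope_sumr // F0 Fn; congr (_ - _).
  by apply: eq_bigr => i _; rewrite mxE.
rewrite sumE; apply: le_trans (ler_norm_sum _ _ _) _.
have step (k : 'I_n) : `|phi (F k.+1) - phi (F k) - partial k phi x * (y - x) 0 k| <=
    e' * enorm (y - x).
  pose b := (y - x) 0 k.
  have Fb : F k.+1 = F k + b *: delta_mx 0 k.
    apply/rowP => i; rewrite /b !mxE eqxx /= ltnS leq_eqVlt -(inj_eq val_inj) /=.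
    case: eqVneq => [/val_inj ->|ik] /=; first by rewrite ltnn mulr1; ring.
    by rewrite mulr0 addr0.
  have near t : `|t| <= `|b| -> enorm (F k + t *: delta_mx 0 k - x) <= enorm (y - x).
    move=> tb; apply: enorm_le_coord => i; rewrite !mxE eqxx /=.
    have [->|ik] := eqVneq i k.
      by rewrite ltnn mulr1 addrAC subrr add0r; move: tb; rewrite /b !mxE.
    rewrite mulr0 addr0; case: ifP => // _.
    by rewrite subrr normr0.
  have [t tb|c cb] := @mean_value (fun t => phi (F k + t *: delta_mx 0 k))
    (fun t => partial k phi (F k + t *: delta_mx 0 k)) b.
    by apply: is_derive_translate; apply: dphi; apply: hr;
      apply: le_lt_trans (near _ tb) yr.
  rewrite scale0r addr0 -Fb => ->; rewrite -mulrBl normrM.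
  apply: ler_pM => //; last exact: normr_coord_le.
  by apply/ltW/hd; apply: le_lt_trans (near _ cb) yd.
apply: le_trans (ler_sum _ (fun k _ => step k)) _.
rewrite sumr_const card_ord -mulr_natl mulrA ler_wpM2r ?enorm_ge0 //.
by rewrite /e' mulrCA ger_pMr // ler_pdivrMr // mul1r ler_nat.
Qed.

Lemma has_gradientB phi psi x p (q : 'rV[R]_n) : has_gradient phi x p ->
  has_gradient psi x q -> has_gradient (fun y => phi y - psi y) x (p - q).
Proof.
move=> hp hq e e0; have e20 : 0 < e / 2 by rewrite divr_gt0.
have [d1 d10 h1] := hp _ e20; have [d2 d20 h2] := hq _ e20.
exists (Num.min d1 d2); first by rewrite lt_min d10.
move=> y; rewrite lt_min => /andP[/h1 + /h2].
rewrite dotDl dotNl !ler_norml => /andP[? ?] /andP[? ?].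
by apply/andP; split; lra.
Qed.

Lemma gradient_quadE x p (G : 'M[R]_n) z :
  gradient (quad x p G) z = p + (z - x) *m (G + G^T).
Proof.
apply/rowP => i; rewrite mxE partial_quad /affine !mxE; congr (_ + _).
by apply: eq_bigr => j _; rewrite !mxE; ring.
Qed.

Lemma dot_mul_tr p (G : 'M[R]_n) : dot (p *m G^T) p = dot (p *m G) p.
Proof.
rewrite /dot; under eq_bigr do rewrite mxE mulr_suml.
rewrite exchange_big /=; apply: eq_bigr => i _; rewrite mxE mulr_suml.
by apply: eq_bigr => j _; rewrite !mxE; ring.
Qed.

Definition half_hessian phi x : 'M[R]_n :=
  \matrix_(i, j) (partial j (partial i phi) x / 2).

Lemma dot_half_hessian phi x p :
  2 * dot (p *m half_hessian phi x) p =
  \sum_i p 0 i * dot (gradient (partial i phi) x) p.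
Proof.
rewrite /dot mulr_sumr.
under eq_bigr do rewrite mxE mulr_suml mulr_sumr.
rewrite exchange_big /=; apply: eq_bigr => i _; rewrite mulr_sumr.
by apply: eq_bigr => j _; rewrite !mxE; field.
Qed.

Lemma infinity_laplacian_half_hessian phi x :
  2 * dot (gradient phi x *m half_hessian phi x) (gradient phi x) =
  infinity_laplacian phi x.
Proof.
rewrite dot_half_hessian; apply: eq_bigr => i _; rewrite mulr_sumr.
by apply: eq_bigr => j _; rewrite !mxE; ring.
Qed.

(** The mean value theorem on the segment, for [phi] minus its quadratic part. As [z - x] is
    parallel to [y - x], only the quadratic form of the half-Hessian enters, and [dot_mul_tr]
    removes any asymmetry. *)
Lemma C2_taylor U phi x : open U -> C2_on U phi -> U x ->
  forall e, 0 < e -> exists2 d, 0 < d & forall y, enorm (y - x) < d ->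
  `|phi y - phi x - quad x (gradient phi x) (half_hessian phi x) y| <=
    e * enorm (y - x) ^+ 2.
Proof.
move=> oU [C1phi C1d] Ux e e0.
set p := gradient phi x; set G := half_hessian phi x.
pose e' := e / n.+1%:R; have e'0 : 0 < e' by rewrite divr_gt0.
have [r r0 hr] := (open_enormP _).1 oU _ Ux.
have near_i i : \forall y \near x, `|partial i phi y - partial i phi x -
    dot (gradient (partial i phi) x) (y - x)| <= e' * enorm (y - x).
  by apply/near_enormP; exact: (C1_has_gradient oU (C1d i) Ux).
have /near_enormP [d d0 hd] : \forall y \near x, forall i,
    `|partial i phi y - partial i phi x - dot (gradient (partial i phi) x) (y - x)| <=
      e' * enorm (y - x) by exact: filter_forall near_i.
exists (Num.min d r); first by rewrite lt_min d0.
move=> y; rewrite lt_min => /andP[yd yr].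
pose psi z := phi z - quad x p G z.
have lt1 t : `|t| <= `|1 : R| -> enorm (line x y t - x) <= enorm (y - x).
  rewrite normr1 -[X in _ - X](line0 x y) enorm_line subr0 => t1.
  by rewrite ler_piMl ?enorm_ge0.
have [t t1|c c1] := @mean_value (fun t => psi (line x y t)) (fun t =>
    dot (gradient phi (line x y t) - gradient (quad x p G) (line x y t)) (y - x)) 1.
  apply: has_gradient_line; apply: has_gradientB.
    by apply: (C1_has_gradient oU C1phi); apply: hr; apply: le_lt_trans (lt1 _ t1) yr.
  by apply: (C1_has_gradient (U := setT)) => //;
    [exact: openT|have [] := C2_quad setT x p G].
rewrite line1 line0 mulr1 {1 2}/psi quad_center subr0 addrAC => ->.
set z := line x y c.
have zx : z - x = c *: (y - x) by rewrite /z /line addrAC subrr add0r.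
have gq : dot (gradient (quad x p G) z) (y - x) =
    dot p (y - x) + \sum_i (y - x) 0 i * dot (gradient (partial i phi) x) (z - x).
  rewrite gradient_quadE dotDl zx -scalemxAl dotZl mulmxDr dotDl dot_mul_tr.
  rewrite -mulr2n -mulr_natl dot_half_hessian mulr_sumr; congr (_ + _).
  by apply: eq_bigr => i _; rewrite dotZr mulrCA.
have zy : enorm (z - x) <= enorm (y - x) by apply: lt1.
rewrite dotDl dotNl gq opprD addrA -dotNl -dotDl /dot -sumrB.
apply: le_trans (ler_norm_sum _ _ _) _.
have step (i : 'I_n) : `|(gradient phi z - p) 0 i * (y - x) 0 i -
    (y - x) 0 i * dot (gradient (partial i phi) x) (z - x)| <=
    e' * enorm (y - x) ^+ 2.
  rewrite mulrC -mulrBr normrM expr2 mulrCA; apply: ler_pM => //.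
    exact: normr_coord_le.
  have := hd _ (le_lt_trans zy yd) i; rewrite !mxE => /le_trans; apply.
  by rewrite ler_wpM2l // ltW.
apply: le_trans (ler_sum _ (fun i _ => step i)) _.
rewrite sumr_const card_ord -mulr_natl mulrA ler_wpM2r ?sqr_ge0 //.
by rewrite /e' mulrCA ger_pMr // ler_pdivrMr // mul1r ler_nat.
Qed.

Lemma dot_mulD_scalar (G : 'M[R]_n) e p :
  dot (p *m (G + e%:M)) p = dot (p *m G) p + e * enorm p ^+ 2.
Proof. by rewrite mulmxDr mul_mx_scalar dotDl dotZl enorm_sqr. Qed.

Lemma quadD_scalar x p (G : 'M[R]_n) e y :
  quad x p (G + e%:M) y = quad x p G y + e * enorm (y - x) ^+ 2.
Proof. by rewrite /quad dot_mulD_scalar addrA. Qed.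

(** Adding [q] times the identity to the half-Hessian puts the paraboloid above [phi] near [x] and
    changes the infinity Laplacian by at most [e]. Paraboloids are smooth on every domain, so tests
    can be moved between domains. *)
Lemma infinity_laplacian_ge0_test U u phi x : open U -> U x -> C2_on U phi ->
  (forall p G, strict_local_max (fun y => u y - quad x p G y) x ->
    0 <= infinity_laplacian (quad x p G) x) ->
  strict_local_max (fun y => u y - phi y) x -> 0 <= infinity_laplacian phi x.
Proof.
move=> oU Ux C2 hq /dnear_enormP [d d0 hd]; apply/ler_addgt0Pr => e e0.
set p := gradient phi x; set G := half_hessian phi x.
have m0 : 0 < 2 * (enorm p ^+ 2 + 1) by rewrite mulr_gt0 // ltr_pwDr ?sqr_ge0.
have q0 : 0 < e / (2 * (enorm p ^+ 2 + 1)) by rewrite divr_gt0.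
set q := e / _ in q0.
have [r r0 hr] := C2_taylor oU C2 Ux q0.
have : 0 <= infinity_laplacian (quad x p (G + q%:M)) x.
  apply: hq; apply/dnear_enormP; exists (Num.min d r); first by rewrite lt_min d0.
  move=> y yx; rewrite lt_min => /andP[/(hd _ yx) + /hr].
  rewrite quad_center quadD_scalar -/p -/G ler_norml => ? /andP[? ?]; lra.
rewrite infinity_laplacian_quad dot_mulD_scalar mulrDr infinity_laplacian_half_hessian.
move=> /le_trans; apply; rewrite lerD2l.
have qm : q * (2 * (enorm p ^+ 2 + 1)) = e by rewrite /q divfK // gt_eqF.
by rewrite -[leRHS]qm mulrCA ler_wpM2l ?(ltW q0) // ler_pM2l // lerDl.
Qed.

Lemma infinity_laplacian_le0_test U u phi x : open U -> U x -> C2_on U phi ->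
  (forall p G, strict_local_min (fun y => u y - quad x p G y) x ->
    infinity_laplacian (quad x p G) x <= 0) ->
  strict_local_min (fun y => u y - phi y) x -> infinity_laplacian phi x <= 0.
Proof.
move=> oU Ux C2 hq /dnear_enormP [d d0 hd]; apply/ler_addgt0Pr => e e0.
set p := gradient phi x; set G := half_hessian phi x.
have m0 : 0 < 2 * (enorm p ^+ 2 + 1) by rewrite mulr_gt0 // ltr_pwDr ?sqr_ge0.
have q0 : 0 < e / (2 * (enorm p ^+ 2 + 1)) by rewrite divr_gt0.
set q := e / _ in q0.
have [r r0 hr] := C2_taylor oU C2 Ux q0.
have : infinity_laplacian (quad x p (G + (- q)%:M)) x <= 0.
  apply: hq; apply/dnear_enormP; exists (Num.min d r); first by rewrite lt_min d0.
  move=> y yx; rewrite lt_min => /andP[/(hd _ yx) + /hr].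
  rewrite quad_center quadD_scalar -/p -/G ler_norml => ? /andP[? ?]; lra.
rewrite infinity_laplacian_quad dot_mulD_scalar mulrDr infinity_laplacian_half_hessian.
have qm : q * (2 * (enorm p ^+ 2 + 1)) = e by rewrite /q divfK // gt_eqF.
move: qm; rewrite -/p add0r; set E := enorm p ^+ 2; set L := infinity_laplacian _ _.
lra.
Qed.

End taylor.

(** * The theorem *)

(** In dimension 0 punctured neighbourhoods are empty, so every maximum is strict and the zero
    gradient violates the constraint. *)
Lemma jensen_subsolution_dim (R : realType) (n : nat) (U : set 'rV[R]_n)
    (z : 'rV[R]_n -> R) : U !=set0 ->
  viscosity_subsolution (gradient_constraint (cst 1)) U z -> 'I_n.
Proof.
case: n U z => [|n] U z U0; last by move=> _; exact: ord0.
move=> sub; exfalso; have [x Ux] := U0.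
have ng := no_small_gradient_subsolution (@subset_refl _ U) (fun _ _ => erefl) sub.
apply: (ng x 0 0 Ux); first by rewrite enorm0.
apply/dnear_enormP; exists 1 => // y; rewrite (thinmx0 y) (thinmx0 x).
by rewrite eqxx.
Qed.

Lemma bounded_set_outside (R : realType) (n : nat) (U : set 'rV[R]_n) (i0 : 'I_n) :
  bounded_set U -> exists y, ~ U y.
Proof.
move=> [M [_ hM]]; exists ((`|M| + 2) *: delta_mx 0 i0) => Uy.
have M1 : M < `|M| + 1 by have := ler_norm M; lra.
have M0 := normr_ge0 M; have := hM _ M1 _ Uy.
have := coord_le_norm ((`|M| + 2) *: delta_mx 0 i0 : 'rV[R]_n) i0.
by rewrite !mxE !eqxx mulr1 ger0_norm /=; lra.
Qed.

Lemma viscosity_subsolution_subset (R : realType) (n : nat) (U V : set 'rV[R]_n)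
    (u : 'rV[R]_n -> R) : open V -> V `<=` U ->
  viscosity_subsolution infinity_laplacian U u ->
  viscosity_subsolution infinity_laplacian V u.
Proof.
move=> oV VU [usc sub]; split=> [x a Vx|x phi Vx C2]; first exact: usc (VU _ Vx).
apply: (infinity_laplacian_ge0_test oV Vx C2) => p G.
exact: sub (VU _ Vx) (C2_quad _ _ _ _).
Qed.

Theorem theorem4p2 (R : realType) (n : nat) (Omega D : set 'rV[R]_n)
  (f h z u : 'rV[R]_n -> R)
  (Omega_nonempty : Omega !=set0)
  (Omega_open : open Omega)
  (Omega_connected : connected Omega)
  (Omega_bounded : bounded_set Omega)
  (f_continuous : {within boundary Omega, continuous f})
  (D_sub : D `<=` Omega)
  (D_regular : closure (D°) = closure D)
  (h_sol : unique_dirichlet infinity_harmonic Omega f h)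
  (h_differentiable : forall x, Omega x -> differentiable h x)
  (z_sol : unique_dirichlet jensen_solution Omega f z)
  (u_sol : dirichlet (constrained_solution D) Omega f u) :
  let A := small_gradient_set Omega h in
  let B := A `&` D in
  (forall x, B x -> u x = z x) /\
  infinity_harmonic (Omega `\` closure B) u.
Proof.
move=> A B.
have [[ch [_ h_sub h_sup] hf] _] := h_sol.
have [[cz [_ z_sub z_sup] zf] _] := z_sol.
have [cu [_ u_sub u_sup] uf] := u_sol.
have i0 := jensen_subsolution_dim Omega_nonempty z_sub.
have OK : Omega `<=` closure Omega := @subset_closure _ Omega.
have inO (v : 'rV[R]_n -> R) : {within closure Omega, continuous v} ->
    {within Omega, continuous v}.
  by move=> cv; exact: continuous_subspaceW OK cv.
have smooth : infinity_smooth Omega h.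
  by split=> //; [exact: inO|exact: no_touching_above_subsolution].
have [_ _ h_nt _] := smooth.
have oA : open A := open_small_gradient_set smooth.
have AO : A `<=` Omega by move=> x [].
have lip x y : closure Omega y -> segment_in A x y -> h y - enorm (y - x) <= h x.
  by move=> Ky xy; exact: lipschitz_small_gradient smooth ch OK Ky xy.
have asc x r : ~ A x -> 0 < r -> eball x r `<=` Omega -> exists y,
    [/\ eball x r y, ~ A y, h x + r <= h y & forall z, eball x r z -> h z <= h y].
  exact: small_gradient_ascent smooth.
have outside : exists y, ~ A y.
  have [y nOy] := bounded_set_outside i0 Omega_bounded.
  by exists y => /AO.
have bE x : boundary Omega x -> closure Omega x /\ ~ A x.
  move=> [Kx nOx]; split => // /AO Ox; apply: nOx.
  by rewrite (interior_id _).1.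
pose w := patch Omega A h.
have cw : {within closure Omega, continuous w}.
  exact: within_continuous_patch oA AO outside ch lip.
have w_out x : closure Omega x -> ~ A x -> w x = h x.
  exact: patch_notin AO outside lip _.
have w_step x y : segment_in A x y -> w y - enorm (y - x) <= w x.
  exact: patch_step.
have w_doubling : doubling Omega w.
  exact: (patch_doubling oA AO outside ch lip asc (inO _ ch) h_nt).
have w_slope : slope_ge 1 Omega w.
  exact: (patch_slope oA AO outside ch lip asc).
clearbody w.
have u_sub' := subsolution_infinity_laplacian u_sub.
have z_sub' := subsolution_infinity_laplacian z_sub.
have u_nt := no_touching_above_subsolution u_sub'.
have z_nt := no_touching_above_subsolution z_sub'.
have le_h (v : 'rV[R]_n -> R) : {within closure Omega, continuous v} ->
    no_touching_above Omega 0 v -> (forall x, boundary Omega x -> v x = f x) ->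
    forall x, closure Omega x -> v x <= h x.
  move=> cv nt vf; apply: (comparison_principle i0 (lexx 0)) => //.
  - exact: doubling_subsolution (inO _ cv) nt.
  - exact: slope_ge0.
  - apply: halving_supersolution => //; first exact: inO.
    exact: no_touching_above_supersolution.
  - by move=> x bx; rewrite vf // hf.
have w_le (v : 'rV[R]_n -> R) : {within closure Omega, continuous v} ->
    no_touching_above Omega 1 (fun y => - v y) ->
    (forall x, boundary Omega x -> v x = f x) ->
    forall x, closure Omega x -> w x <= v x.
  move=> cv nt vf; apply: (comparison_principle i0 ler01) => //.
  - by apply: halving_supersolution => //; exact: inO.
  - by move=> x bx; have [Kx nAx] := bE _ bx; rewrite w_out // vf // hf.
have indic_le1 (S : set 'rV[R]_n) x : \1_S x <= 1 :> R.
  by rewrite indicE; case: (_ \in _).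
have u_le := le_h _ cu u_nt uf.
have z_le := le_h _ cz z_nt zf.
have u_ge : forall x, closure Omega x -> w x <= u x.
  by apply: w_le => //; exact: no_touching_above_constraint u_sup.
have z_ge : forall x, closure Omega x -> w x <= z x.
  by apply: w_le => //; apply: no_touching_above_constraint z_sup.
have le_w (v : 'rV[R]_n -> R) V : {within closure Omega, continuous v} ->
    no_touching_above Omega 0 v -> (forall x, closure Omega x -> v x <= h x) ->
    open V -> V `<=` Omega -> no_small_gradient V v ->
    forall x, A x -> V x -> v x <= w x.
  move=> cv nt vh oV VO ng x Ax Vx.
  have v_out y : closure Omega y -> ~ A y -> v y <= w y.
    by move=> Ky nAy; rewrite (w_out _ Ky nAy); exact: vh.
  apply: (le_of_ascends Omega_open Omega_bounded oA AO cv cw nt v_out w_step Ax).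
  apply: ascends_subdomain (inO _ cv) nt oV _ Vx => y r r0 BV.
  have [t tB ht] := slope_ge1 ng r0 BV
    (continuous_subspaceW (subset_trans BV VO) (inO _ cv)).
  by exists t => //; rewrite mul1r.
have z_eq x : A x -> z x = w x.
  move=> Ax; apply/eqP; rewrite eq_le z_ge ?andbT; last exact/OK/AO.
  apply: (le_w _ _ cz z_nt z_le Omega_open _ _ _ Ax (AO _ Ax)) => //.
  exact: no_small_gradient_subsolution (@subset_refl _ _) (fun _ _ => erefl) z_sub.
have DO : D° `<=` Omega := subset_trans (@interior_subset _ D) D_sub.
have u_eq x : A x -> D° x -> u x = w x.
  move=> Ax Dx; apply/eqP; rewrite eq_le u_ge ?andbT; last exact/OK/AO.
  apply: (le_w _ _ cu u_nt u_le (@open_interior _ D) DO _ _ Ax Dx).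
  apply: (no_small_gradient_subsolution DO _ u_sub) => y Dy.
  by rewrite indicE mem_set.
split=> [x [Ax Dx]|].
  (* A point of [D] need not be interior, but [D_regular] makes it a limit of interior points. These
     lie in the open set [A] eventually, where both functions equal [w]. *)
  apply/eqP; rewrite -subr_eq0 -normr_le0; apply/ler_addgt0Pr => e e0; rewrite add0r.
  have cuz : {within Omega, continuous (fun y => u y - z y)}.
    by move=> y; apply: cvgB; [exact: (inO _ cu)|exact: (inO _ cz)].
  have [d d0 hd] := (within_continuous_enormP _ _).1 cuz _ (AO _ Ax) _ e0.
  have [r r0 hr] := (open_enormP _).1 oA _ Ax.
  have dr0 : 0 < Num.min d r by rewrite lt_min d0.
  have Dcl : closure D° x by rewrite D_regular; exact: subset_closure.
  have [y Dy yx] := (closure_enormP _ _).1 Dcl _ dr0.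
  move: yx; rewrite lt_min => /andP[yd yr].
  have Ay : A y := hr _ yr.
  have := hd y (DO _ Dy) yd.
  by rewrite (u_eq _ Ay Dy) (z_eq _ Ay) subrr sub0r normrN => /ltW.
have oE : open (Omega `\` closure B).
  by rewrite setDE; apply: openI => //; apply: closed_openC; exact: closed_closure.
have EO : Omega `\` closure B `<=` Omega by move=> x [].
split; first exact: continuous_subspaceW EO (inO _ cu).
  exact: viscosity_subsolution_subset oE EO u_sub'.
have [lsc sup] := u_sup.
split=> [x a [Ox _]|x phi Ex C2]; first exact: lsc.
apply: (infinity_laplacian_le0_test oE Ex C2) => p G min_u.
have [Ox nBx] := Ex.
(* In the closure of [D], the point is outside [A], since [A] is open and [x] is not in the closure
   of [B]. Then [u x = h x] and [u <= h], so a function touching [u] from below also touches [h]. *)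
have [clDx|nclDx] := pselect (closure D x).
  have nAx : ~ A x.
    move=> Ax; apply: nBx; apply/closure_enormP => e e0.
    have [r r0 hr] := (open_enormP _).1 oA _ Ax.
    have er0 : 0 < Num.min e r by rewrite lt_min e0.
    have [y Dy] := (closure_enormP _ _).1 clDx _ er0.
    rewrite lt_min => /andP[ye yr].
    by exists y; [split; [exact: hr|exact: Dy]|exact: ye].
  have ux : u x = h x.
    have Kx := OK _ Ox; apply/eqP; rewrite eq_le (u_le _ Kx) /=.
    by rewrite -(w_out _ Kx nAx); exact: u_ge.
  have [_ h_test] := h_sup; apply: (h_test x _ Ox (C2_quad _ _ _ _)).
  have [r r0 hr] := (open_enormP _).1 Omega_open _ Ox.
  have [d d0 hd] := (dnear_enormP _ _).1 min_u.
  apply/dnear_enormP; exists (Num.min d r); first by rewrite lt_min d0.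
  move=> y yx; rewrite lt_min => /andP[/(hd _ yx) + /hr /OK /u_le].
  by rewrite ux; lra.
(* Away from the closure of [D] the constraint is |p| >= 0; if its term is the nonpositive one, then
   [p = 0] and the infinity Laplacian vanishes. *)
have := sup _ _ Ox (C2_quad _ _ _ _) min_u.
rewrite /gradient_constraint indicE memNset // subr0 ge_min => /orP[//|].
rewrite gradient_quad => p0.
have /enorm0_eq0 -> : enorm p = 0 by apply/eqP; rewrite eq_le p0 enorm_ge0.
by rewrite infinity_laplacian_quad mul0mx -(scale0r (0 : 'rV[R]_n)) dotZr mul0r mulr0.
Qed.
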